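(* Let $\mathbf{k}$ be an algebraically closed field of characteristic zero and let $\Delta$ be a fully hidden simplicial complex on $[n]$. Then $$\operatorname{Aut}(X_\Delta)=T_0\rtimes S(\Delta),$$ a linear algebraic group of dimension $n$ whose identity component is $T_0$.
   Context: $\mathbf{k}$ is an algebraically closed field of characteristic zero. For $n\ge 1$, $[n]=\{1,\dots,n\}$. A simplicial complex $\Delta$ on $[n]$ is a collection of subsets of $[n]$ (faces) closed under taking subsets; it is always assumed that $\{i\}\in\Delta$ for every $i\in[n]$. Facets are the inclusion-maximal faces; $\mathcal F(\Delta)$ is the set of facets, and $\mathcal F_\sigma(\Delta)=\{F\in\mathcal F(\Delta):\sigma\subseteq F\}$ for $\sigma\subseteq[n]$. For a face $S$, $\operatorname{cl}(S)=\bigcap_{F\in\mathcal F_S(\Delta)}F$. For $i\in[n]$, $\mathcal A_i(\Delta)=\{S\subseteq[n]\setminus\{i\}: S\in\Delta,\ i\in\operatorname{cl}(S)\}$. A facet $F$ is exposed if there exist $i\in[n]$ and $S\in\mathcal A_i(\Delta)$ with $S\subseteq F$, and hidden otherwise. $\Delta$ is fully hidden if every facet is hidden. Stanley-Reisner variety: $\mathbf k[\Delta]=\mathbf k[x_1,\dots,x_n]/I_\Delta$ with $I_\Delta=(\prod_{i\in\sigma}x_i:\sigma\subseteq[n],\sigma\notin\Delta)$, $X_\Delta=\operatorname{Spec}\mathbf k[\Delta]$, $\overline{x}_i$ the class of $x_i$. $\operatorname{Aut}(X_\Delta)=\operatorname{Aut}_{\mathbf k}(\mathbf k[\Delta])$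 is the automorphism group; it is an ind-group (a group with a compatible ascending filtration by closed algebraic varieties): $\varphi$ is identified with $(\varphi,\varphi^{-1})$, and the $d$-th filtration piece consists of pairs for which $\varphi$ and $\varphi^{-1}$ both send every $\overline{x}_l$ to an element of total degree at most $d$, a closed subvariety of a finite-dimensional vector space. $T_0=(\mathbf k^* )^n$ is the standard torus, embedded in $\operatorname{Aut}(X_\Delta)$ by $t\cdot\overline x_i=t_i\overline x_i$. $S(\Delta)\subseteq S_n$ is the group of permutations $\sigma$ of $[n]$ with $\{\sigma(A):A\in\Delta\}=\Delta$, embedded in $\operatorname{Aut}(X_\Delta)$ by letting $\sigma$ act as $\rho_\sigma:\overline{x}_i\mapsto\overline{x}_{\sigma(i)}$. The equality means that $\operatorname{Aut}(X_\Delta)$ is the internal semidirect product of these two subgroups, with $T_0$ normal. *)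

(* Defs.v *)
From HB Require Import structures.
From mathcomp Require Import all_boot all_order all_algebra all_fingroup.
From mathcomp Require Import generic_quotient ring_quotient.
From mathcomp Require Import boolp classical_sets.
From mathcomp Require Import topology_structure connected.
From mathcomp Require Import mpoly.

Set Implicit Arguments.
Unset Strict Implicit.
Unset Printing Implicit Defensive.

Import GRing.Theory.

Local Open Scope classical_set_scope.
Local Open Scope ring_scope.

(* The vertex set [n] = {1, .., n} is represented by 'I_n = {0, .., n - 1}.
   For n >= 1 the field [face0] follows from the two others. *)
Record complex (n : nat) := Complex {
  faces :> {set {set 'I_n}};
  face0 : finset.set0 \in faces;
  face_sub : forall S F : {set 'I_n}, S \subset F -> F \in faces -> S \in faces;
  face1 : forall i : 'I_n, finset.set1 i \in faces
}.

Section FullyHidden.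
Context (n : nat) (D : complex n).

Definition facets : {set {set 'I_n}} :=
  finset (fun F => maxset [pred G | G \in faces D] F).

Definition facets_over (S : {set 'I_n}) : {set {set 'I_n}} :=
  [set F in facets | S \subset F]%SET.

Definition cl (S : {set 'I_n}) : {set 'I_n} :=
  (\bigcap_(F in facets_over S) F)%SET.

Definition pre_closed (i : 'I_n) : {set {set 'I_n}} :=
  [set S in faces D | (i \notin S) && (i \in cl S)]%SET.

Definition exposed (F : {set 'I_n}) : bool :=
  [exists i : 'I_n, exists S in pre_closed i, S \subset F].

Definition hidden (F : {set 'I_n}) : bool := ~~ exposed F.

Definition fully_hidden : bool := [forall F in facets, hidden F].

Definition sym_complex : {set 'S_n} :=
  finset (fun s : 'S_n =>
    [set [set s i | i in A]%SET | A : {set 'I_n} in faces D]%SET == faces D).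

End FullyHidden.

Section StanleyReisnerRing.
Context (k : fieldType) (n : nat) (D : complex n).
Local Notation mon S := (\prod_(i in S) 'X_i : {mpoly k[n]}).

Definition sr_ideal : pred {mpoly k[n]} := fun p =>
  `[< exists c : {set 'I_n} -> {mpoly k[n]},
        p = \sum_(S : {set 'I_n} | S \notin faces D) c S * mon S >].

Lemma sr_idealr_closed : idealr_closed sr_ideal.
Proof.
split.
- by apply/asboolP; exists (fun=> 0); rewrite big1 // => S _; rewrite mul0r.
- apply/negP => /asboolP [c] /(congr1 (meval (fun=> 0))).
  rewrite meval1 raddf_sum /= big1 => [/eqP|S SD]; first by rewrite oner_eq0.
  rewrite mevalM; have [S0|[i iS]] := finset.set_0Vmem S.
    by move: SD; rewrite S0 face0.
  by rewrite (bigD1 i) //= mevalM mevalXU mul0r mulr0.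
- move=> a p q /asboolP[c ->] /asboolP[d ->]; apply/asboolP.
  exists (fun S => a * c S + d S).
  rewrite mulr_sumr -big_split /=; apply: eq_bigr => S _.
  by rewrite mulrDl mulrA.
Qed.

HB.instance Definition _ := isIdealr.Build {mpoly k[n]} sr_ideal sr_idealr_closed.

Definition sr_idealr : idealr {mpoly k[n]} := Idealr.clone _ sr_ideal _.

Definition sr_ring : Type := {ideal_quot sr_idealr}.
HB.instance Definition _ := GRing.ComNzRing.on sr_ring.

Definition sr_pi (p : {mpoly k[n]}) : sr_ring := (\pi_({ideal_quot sr_idealr}) p)%qT.
HB.instance Definition _ := GRing.RMorphism.copy sr_pi
  (\pi_({ideal_quot sr_idealr}) : {mpoly k[n]} -> {ideal_quot sr_idealr})%qT.

Definition sr_scale (a : k) (x : sr_ring) : sr_ring := sr_pi a%:MP * x.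

Lemma sr_scaleA a b x : sr_scale a (sr_scale b x) = sr_scale (a * b) x.
Proof. by rewrite /sr_scale mulrA -rmorphM -mpolyCM. Qed.
Lemma sr_scale1 : left_id 1 sr_scale.
Proof. by move=> x; rewrite /sr_scale rmorph1 mul1r. Qed.
Lemma sr_scaleDr : right_distributive sr_scale +%R.
Proof. by move=> a x y; rewrite /sr_scale mulrDr. Qed.
Lemma sr_scaleDl x : {morph sr_scale^~ x : a b / a + b}.
Proof. by move=> a b; rewrite /sr_scale mpolyCD rmorphD mulrDl. Qed.
HB.instance Definition _ := GRing.Zmodule_isLmodule.Build k sr_ring
  sr_scaleA sr_scale1 sr_scaleDr sr_scaleDl.

Lemma sr_scaleAl (a : k) (x y : sr_ring) : a *: (x * y) = (a *: x) * y.
Proof. exact: mulrA. Qed.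
HB.instance Definition _ := GRing.Lmodule_isLalgebra.Build k sr_ring sr_scaleAl.
HB.instance Definition _ := GRing.Lalgebra_isComAlgebra.Build k sr_ring.

Lemma sr_piZ : scalable sr_pi.
Proof. by move=> a p; rewrite -mul_mpolyC rmorphM. Qed.
HB.instance Definition _ := GRing.isScalable.Build k {mpoly k[n]} sr_ring *:%R
  sr_pi sr_piZ.

Definition xbar (i : 'I_n) : sr_ring := sr_pi 'X_i.

(* [msize p <= d.+1] means that p has total degree at most d. *)
Definition deg_le (d : nat) (a : sr_ring) : Prop :=
  exists2 p : {mpoly k[n]}, (msize p <= d.+1)%N & a = sr_pi p.

End StanleyReisnerRing.

Section Automorphisms.
Context (k : fieldType) (n : nat) (D : complex n).
Local Notation A := (sr_ring k D).

Record sr_aut := SrAut {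
  aut_fun :> {lrmorphism A -> A};
  aut_inv : {lrmorphism A -> A};
  aut_funK : cancel aut_fun aut_inv;
  aut_invK : cancel aut_inv aut_fun
}.

Lemma lrmorphism_eq (f g : {lrmorphism A -> A}) : f =1 g -> f = g.
Proof.
case: f => f [[f1] [f2] [f3]]; case: g => g [[g1] [g2] [g3]] /= fg.
have {fg}e : f = g by apply: funext.
case: _ / e in g1 g2 g3 *.
by rewrite (Prop_irrelevance f1 g1) (Prop_irrelevance f2 g2)
  (Prop_irrelevance f3 g3).
Qed.

Lemma sr_aut_eq (f g : sr_aut) : f =1 g -> f = g.
Proof.
move=> fg; have fg' : aut_fun f = aut_fun g by apply: lrmorphism_eq.
have fgV : aut_inv f = aut_inv g.
  by apply: lrmorphism_eq => x; rewrite -{1}(aut_invK g x) -fg' aut_funK.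
case: f g fg' fgV {fg} => [f fV f1 f2] [g gV g1 g2] /= e e'.
case: _ / e in g1 g2 *; case: _ / e' in g1 g2 *.
by rewrite (Prop_irrelevance f1 g1) (Prop_irrelevance f2 g2).
Qed.

HB.instance Definition _ := gen_eqMixin sr_aut.
HB.instance Definition _ := gen_choiceMixin sr_aut.

Definition aut_one : sr_aut :=
  @SrAut idfun idfun (fun=> erefl) (fun=> erefl).
Definition aut_opp (f : sr_aut) : sr_aut :=
  SrAut (aut_invK f) (aut_funK f).
Definition aut_mul (f g : sr_aut) : sr_aut :=
  @SrAut (aut_fun f \o aut_fun g) (aut_inv g \o aut_inv f)
    (can_comp (aut_funK f) (aut_funK g)) (can_comp (aut_invK g) (aut_invK f)).

Lemma aut_mulA : associative aut_mul.
Proof. by move=> f g h; apply: sr_aut_eq. Qed.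
Lemma aut_mul1g : left_id aut_one aut_mul.
Proof. by move=> f; apply: sr_aut_eq. Qed.
Lemma aut_mulg1 : right_id aut_one aut_mul.
Proof. by move=> f; apply: sr_aut_eq. Qed.
Lemma aut_mulVg : left_inverse aut_one aut_opp aut_mul.
Proof. by move=> f; apply: sr_aut_eq => x /=; rewrite aut_funK. Qed.
Lemma aut_mulgV : right_inverse aut_one aut_opp aut_mul.
Proof. by move=> f; apply: sr_aut_eq => x /=; rewrite aut_invK. Qed.
HB.instance Definition _ := isGroup.Build sr_aut
  aut_mulA aut_mul1g aut_mulg1 aut_mulVg aut_mulgV.

End Automorphisms.
Arguments sr_aut : clear implicits.
Arguments sr_aut k {n} D.

Section UniversalProperty.
Context (k : fieldType) (n : nat) (D : complex n).
Local Notation A := (sr_ring k D).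

Definition sr_compat (q : 'I_n -> A) : Prop :=
  forall S : {set 'I_n}, S \notin faces D -> \prod_(i in S) q i = 0.

Definition sr_lift (q : 'I_n -> A) (cq : sr_compat q) (a : A) : A :=
  mmap (in_alg A) q (repr a).

Section Lift.
Context (q : 'I_n -> A) (cq : sr_compat q).

Lemma sr_lift_pi p : sr_lift cq (sr_pi D p) = mmap (in_alg A) q p.
Proof.
rewrite /sr_lift; apply/eqP; rewrite -subr_eq0 -rmorphB /=.
have : repr (sr_pi D p) - p \in sr_ideal D.
  by rewrite Quotient.idealrBE reprK.
move=> /asboolP[c ->]; rewrite raddf_sum /= big1 // => S SD.
rewrite rmorphM /= rmorph_prod /=.
under eq_bigr do rewrite mmapX mmap1U.
by rewrite cq // mulr0.
Qed.

Lemma sr_piP (a : A) : exists p, a = sr_pi D p.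
Proof. by exists (repr a); rewrite /sr_pi reprK. Qed.

Lemma sr_lift_zmod : zmod_morphism (sr_lift cq).
Proof.
move=> a b; case: (sr_piP a) (sr_piP b) => [p ->] [r ->].
by rewrite -rmorphB !sr_lift_pi rmorphB.
Qed.
Lemma sr_lift_monoid : monoid_morphism (sr_lift cq).
Proof.
split=> [|a b]; first by rewrite -[X in sr_lift _ X](rmorph1 (@sr_pi k n D)) sr_lift_pi rmorph1.
case: (sr_piP a) (sr_piP b) => [p ->] [r ->].
by rewrite -rmorphM !sr_lift_pi rmorphM.
Qed.
Lemma sr_lift_scale : scalable (sr_lift cq).
Proof.
move=> c a; case: (sr_piP a) => [p ->].
by rewrite -linearZ !sr_lift_pi -mul_mpolyC rmorphM /= mmapC mulr_algl.
Qed.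
HB.instance Definition _ := GRing.isZmodMorphism.Build A A (sr_lift cq) sr_lift_zmod.
HB.instance Definition _ := GRing.isMonoidMorphism.Build A A (sr_lift cq) sr_lift_monoid.
HB.instance Definition _ := GRing.isScalable.Build k A A *:%R (sr_lift cq) sr_lift_scale.

Lemma sr_lift_x i : sr_lift cq (xbar k D i) = q i.
Proof. by rewrite sr_lift_pi mmapX mmap1U. Qed.
End Lift.

Lemma sr_lrmorph_id (f : {lrmorphism A -> A}) :
  (forall i, f (xbar k D i) = xbar k D i) -> f =1 id.
Proof.
move=> fx a; case: (sr_piP a) => [p ->].
elim/mpolyind: p => [|c m p _ _ IH]; first by rewrite !rmorph0.
rewrite !rmorphD /= IH; congr (_ + _).
rewrite !linearZ /=; congr (_ *: _).
rewrite mpolyXE_id !rmorph_prod /=; apply: eq_bigr => i _.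
by rewrite !rmorphXn /= fx.
Qed.

Section LiftAut.
Context (q r : 'I_n -> A) (cq : sr_compat q) (cr : sr_compat r).
Context (qr : forall i, sr_lift cr (q i) = xbar k D i)
  (rq : forall i, sr_lift cq (r i) = xbar k D i).

Lemma sr_liftK : cancel (sr_lift cq) (sr_lift cr).
Proof.
by apply: (sr_lrmorph_id (f := sr_lift cr \o sr_lift cq)) => i /=; rewrite sr_lift_x.
Qed.
Lemma sr_liftVK : cancel (sr_lift cr) (sr_lift cq).
Proof.
by apply: (sr_lrmorph_id (f := sr_lift cq \o sr_lift cr)) => i /=; rewrite sr_lift_x.
Qed.
Definition lift_aut : sr_aut k D :=
  @SrAut k n D (sr_lift cq) (sr_lift cr) sr_liftK sr_liftVK.
End LiftAut.

End UniversalProperty.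

Section Torus.
Context (k : fieldType) (n : nat).

Definition torus : Type := {t : {ffun 'I_n -> k} | [forall i, t i != 0]}.
HB.instance Definition _ := Choice.on torus.

Definition tcoord (t : torus) (i : 'I_n) : k := sval t i.

Lemma tcoord_neq0 t i : tcoord t i != 0.
Proof. exact: (forallP (valP t)). Qed.

Lemma torus_eq (s t : torus) : tcoord s =1 tcoord t -> s = t.
Proof. by move=> st; apply/val_inj/ffunP. Qed.

Definition mk_torus (f : 'I_n -> k) (f0 : forall i, f i != 0) : torus :=
  exist _ [ffun i => f i] (introT forallP (fun i =>
    eq_ind_r (fun y => is_true (y != 0)) (f0 i) (ffunE _ i))).

Lemma mk_torusE f f0 i : tcoord (@mk_torus f f0) i = f i.
Proof. exact: ffunE. Qed.

Lemma torus_one_subproof (i : 'I_n) : (1 : k) != 0.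
Proof. exact: oner_neq0. Qed.
Lemma torus_inv_subproof (t : torus) i : (tcoord t i)^-1 != 0.
Proof. by rewrite invr_neq0 ?tcoord_neq0. Qed.
Lemma torus_mul_subproof (s t : torus) i : tcoord s i * tcoord t i != 0.
Proof. by rewrite mulf_neq0 ?tcoord_neq0. Qed.

Definition torus_one := mk_torus torus_one_subproof.
Definition torus_inv t := mk_torus (torus_inv_subproof t).
Definition torus_mul s t := mk_torus (torus_mul_subproof s t).

Lemma torus_mulA : associative torus_mul.
Proof. by move=> s t u; apply: torus_eq => i; rewrite !mk_torusE mulrA. Qed.
Lemma torus_mul1g : left_id torus_one torus_mul.
Proof. by move=> t; apply: torus_eq => i; rewrite !mk_torusE mul1r. Qed.
Lemma torus_mulg1 : right_id torus_one torus_mul.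
Proof. by move=> t; apply: torus_eq => i; rewrite !mk_torusE mulr1. Qed.
Lemma torus_mulVg : left_inverse torus_one torus_inv torus_mul.
Proof.
by move=> t; apply: torus_eq => i; rewrite !mk_torusE mulVf ?tcoord_neq0.
Qed.
Lemma torus_mulgV : right_inverse torus_one torus_inv torus_mul.
Proof.
by move=> t; apply: torus_eq => i; rewrite !mk_torusE mulfV ?tcoord_neq0.
Qed.
HB.instance Definition _ := isGroup.Build torus
  torus_mulA torus_mul1g torus_mulg1 torus_mulVg torus_mulgV.

End Torus.

Section Embeddings.
Context (k : fieldType) (n : nat) (D : complex n).
Local Notation A := (sr_ring k D).
Local Notation x := (xbar k D).

Lemma prod_xbar (S : {set 'I_n}) : S \notin faces D -> \prod_(i in S) x i = 0.
Proof.
move=> SD; rewrite -(rmorph_prod (@sr_pi k n D)) -(rmorph0 (@sr_pi k n D)).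
apply/eqP; rewrite -Quotient.idealrBE subr0; apply/asboolP.
exists (fun T => (T == S)%:R); rewrite (bigD1 S) //= eqxx mul1r [X in _ + X]big1 ?addr0 //.
by move=> T /andP[_ /negPf->]; rewrite mul0r.
Qed.

Lemma torus_compat (t : torus k n) : sr_compat (fun i => tcoord t i *: x i).
Proof. by move=> S SD; rewrite scaler_prod prod_xbar ?scaler0. Qed.

Lemma torus_autK (t u : torus k n) : (u * t = 1)%g ->
  forall i, sr_lift (torus_compat u) (tcoord t i *: x i) = x i.
Proof.
move=> ut i; rewrite linearZ /= sr_lift_x scalerA mulrC.
by rewrite -(mk_torusE (torus_mul_subproof u t)) [mk_torus _]ut mk_torusE scale1r.
Qed.

Definition torus_aut (t : torus k n) : sr_aut k D :=
  lift_aut (torus_autK (mulVg t)) (torus_autK (mulgV t)).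

Lemma torus_autE t i : torus_aut t (x i) = tcoord t i *: x i.
Proof. exact: sr_lift_x. Qed.

Definition symm : Type := {s : 'S_n | s \in sym_complex D}.

Lemma symm_face (s : 'S_n) (S : {set 'I_n}) : s \in sym_complex D ->
  ([set s i | i in S]%SET \in faces D) = (S \in faces D).
Proof.
rewrite inE => /eqP sD; apply/idP/idP => [|SD]; last first.
  by rewrite -{1}sD; apply: imset_f.
rewrite -{1}sD => /finset.imsetP[T TD] /finset.imset_inj.
by move=> /(_ perm_inj) ->.
Qed.

Lemma symm_compat (s : 'S_n) : s \in sym_complex D ->
  sr_compat (fun i => x (s i)).
Proof.
move=> sD S SD; rewrite -(@finset.big_imset _ _ _ _ _ s (mem S) x) /=.
  by rewrite prod_xbar // symm_face.
by move=> i j _ _; apply: perm_inj.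
Qed.

Lemma symm_inv (s : 'S_n) : s \in sym_complex D -> (s^-1)%g \in sym_complex D.
Proof.
move=> sD; rewrite inE; apply/eqP/setP => T; apply/idP/idP => [/finset.imsetP[S SD ->]|TD].
  rewrite -(symm_face _ sD) -finset.imset_comp (@eq_imset _ _ _ id) ?imset_id //.
  by move=> i /=; rewrite permKV.
apply/finset.imsetP; exists [set s i | i in T]%SET; first by rewrite symm_face.
rewrite -finset.imset_comp (@eq_imset _ _ _ id) ?imset_id //.
by move=> i /=; rewrite permK.
Qed.

Lemma symm_autK (s u : 'S_n) (us : (s * u = 1)%g) (uD : u \in sym_complex D) i :
  sr_lift (symm_compat uD) (x (s i)) = x i.
Proof. by rewrite sr_lift_x -permM us perm1. Qed.

Definition symm_aut (s : symm) : sr_aut k D :=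
  lift_aut (cq := symm_compat (valP s)) (cr := symm_compat (symm_inv (valP s)))
    (symm_autK (mulgV (val s)) (symm_inv (valP s)))
    (symm_autK (mulVg (val s)) (valP s)).

Lemma symm_autE s i : symm_aut s (x i) = x (sval s i).
Proof. exact: sr_lift_x. Qed.

End Embeddings.
Arguments torus_aut {k n} D t.
Arguments symm_aut k {n D} s.

Definition internal_semidirect (G : groupType) (N H : set G) : Prop :=
  [/\ N 1%g /\ (forall a b, N a -> N b -> N (a * b^-1)%g),
      H 1%g /\ (forall a b, H a -> H b -> H (a * b^-1)%g),
      (forall g a, N a -> N (g * a * g^-1)%g),
      N `&` H = [set 1%g]
    & forall g, exists2 a, N a & exists2 b, H b & g = (a * b)%g].

Section PolynomialFunctions.
Context (k : fieldType).

(* The k-algebra of functions generated by the linear forms; for V of finite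
   dimension these are the polynomial functions in any system of linear
   coordinates. *)
Inductive polyfun (V : lmodType k) : (V -> k) -> Prop :=
| polyfun_const c : polyfun (fun=> c)
| polyfun_linear (l : {scalar V}) : polyfun l
| polyfun_add f g : polyfun f -> polyfun g -> polyfun (fun v => f v + g v)
| polyfun_mul f g : polyfun f -> polyfun g -> polyfun (fun v => f v * g v).

Definition zeros (V : lmodType k) (F : set (V -> k)) : set V :=
  [set v | forall f, F f -> f v = 0].

(* Z `&` X is Zariski closed in X, where X is seen inside V through e. *)
Definition zclosed_in (T : Type) (V : lmodType k) (e : T -> V) (X Z : set T) :=
  exists2 F : set (V -> k), F `<=` @polyfun V & X `&` Z = X `&` e @^-1` zeros F.

(* f is on X the restriction of a polynomial function on V. *)
Definition regular_on (T : Type) (V : lmodType k) (e : T -> V) (X : set T)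
    (f : T -> k) : Prop :=
  exists2 g : V -> k, polyfun g & forall a, X a -> f a = g (e a).

Lemma zclosed_in0 T (V : lmodType k) (e : T -> V) X : zclosed_in e X set0.
Proof.
exists [set (fun=> 1)] => [_ ->|]; first exact: polyfun_const.
rewrite setI0; apply/seteqP; split=> // a [_] /(_ _ erefl) /eqP.
by rewrite oner_eq0.
Qed.

Lemma zclosed_inU T (V : lmodType k) (e : T -> V) X Y Z :
  zclosed_in e X Y -> zclosed_in e X Z -> zclosed_in e X (Y `|` Z).
Proof.
move=> [F Fp YF] [G Gp ZG].
exists [set h | exists f g, [/\ F f, G g & h = fun v => f v * g v]].
  by move=> _ [f [g [Ff Gg ->]]]; apply: polyfun_mul; [apply: Fp|apply: Gp].
rewrite setIUr YF ZG; apply/seteqP; split=> a.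
  move=> [] [Xa FGa]; split=> // _ [f [g [Ff Gg ->]]].
    by rewrite (FGa f Ff) mul0r.
  by rewrite (FGa g Gg) mulr0.
move=> [Xa FGa]; have [Fa|] := pselect (zeros F (e a)); first by left.
move=> nF; right; split=> // g Gg; apply: contrapT => /eqP g0.
apply: nF => f Ff; apply/eqP; rewrite -(mulIr_eq0 _ (mulIf g0)); apply/eqP.
by apply: (FGa (fun v => f v * g v)); exists f, g.
Qed.

Lemma zclosed_in_bigcap T (V : lmodType k) (e : T -> V) X I (Z : I -> set T) :
  (forall i, zclosed_in e X (Z i)) -> zclosed_in e X (\bigcap_i Z i).
Proof.
move=> Zc; have /choice[F FP] : forall i, exists F : set (V -> k),
    F `<=` @polyfun V /\ X `&` Z i = X `&` e @^-1` zeros F.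
  by move=> i; have [F] := Zc i; exists F.
exists (\bigcup_i F i) => [f [i _ /(FP i).1]//|].
apply/seteqP; split=> a [Xa aP]; split=> //.
  move=> f [i _ Ff]; have : (X `&` Z i) a by split=> //; apply: aP.
  by rewrite (FP i).2 => -[_]; apply.
move=> i _; suff : (X `&` Z i) a by case.
by rewrite (FP i).2; split=> // f Ff; apply: aP; exists i.
Qed.

End PolynomialFunctions.

Section IndGroup.
Context (k : fieldType) (n : nat) (D : complex n).
Local Notation A := (sr_ring k D).
Local Notation aut := (sr_aut k D).

Definition ind_ambient : lmodType k :=
  ({ffun 'I_n -> A} * {ffun 'I_n -> A})%type.

Definition ind_coord (f : aut) : ind_ambient :=
  ([ffun l => f (xbar k D l)], [ffun l => aut_inv f (xbar k D l)]).

Definition ind_piece (d : nat) : set aut :=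
  [set f : aut | forall l, deg_le d (f (xbar k D l)) /\
                     deg_le d (aut_inv f (xbar k D l))].

(* The d-th piece spans a finite-dimensional subspace of [ind_ambient], to
   which every linear form extends: its Zariski topology is the one induced
   by the polynomial functions on [ind_ambient].  A subset of the ind-variety
   is closed when its trace on each piece is. *)
Definition ind_closed (Z : set aut) : Prop :=
  forall d, zclosed_in ind_coord (ind_piece d) Z.

Definition ind_open (U : set aut) : Prop := ind_closed (~` U).

Lemma ind_openT : ind_open setT.
Proof. by move=> d; rewrite setCT; apply: zclosed_in0. Qed.
Lemma ind_openI : setI_closed ind_open.
Proof. by move=> U V Uo Vo d; rewrite setCI; apply: zclosed_inU. Qed.
Lemma ind_open_bigU (I : Type) (U : I -> set aut) :
  (forall i, ind_open (U i)) -> ind_open (\bigcup_i U i).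
Proof.
by move=> Uo d; rewrite setC_bigcup; apply: zclosed_in_bigcap => i; apply: Uo.
Qed.
HB.instance Definition _ :=
  isOpenTopological.Build aut ind_openT ind_openI ind_open_bigU.

(* GL_N is the principal open subset of 'M_N where det is invertible; its
   regular functions are the polynomials in the entries and det^-1. *)
Definition gl (N : nat) : set 'M[k]_N := [set M | M \in unitmx].
Definition gl_coord (N : nat) (M : 'M[k]_N) : 'M[k]_N * k^o :=
  (M, (\det M)^-1).

(* The ind-group Aut is isomorphic, as an ind-group, to a Zariski closed
   subgroup of some GL_N.  In particular the filtration is stationary and the
   inverse isomorphism is a morphism of varieties into some piece. *)
Definition linear_algebraic_aut : Prop :=
  exists (N : nat) (r : aut -> 'M[k]_N),
    [/\ [/\ forall f, gl (r f),
            forall f g, r (f * g)%g = r f *m r g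
          & injective r],
        zclosed_in (@gl_coord N) (@gl N) (range r),
        forall d i j, regular_on ind_coord (ind_piece d) (fun f => r f i j)
      & exists2 d, (forall f, ind_piece d f) &
          forall l : {scalar ind_ambient},
            exists2 g : 'M[k]_N * k^o -> k, polyfun g &
              forall f, l (ind_coord f) = g (gl_coord (r f))].

End IndGroup.
Arguments linear_algebraic_aut k {n} D.

Section Dimension.
Context (T : topologicalType).

Definition irreducible_set (Z : set T) : Prop :=
  Z !=set0 /\ forall X Y : set T, closed X -> closed Y ->
    Z `<=` X `|` Y -> Z `<=` X \/ Z `<=` Y.

Definition irreducible_chain (m : nat) : Prop :=
  exists Z : nat -> set T,
    (forall i, (i <= m)%N -> closed (Z i) /\ irreducible_set (Z i)) /\
    (forall i, (i < m)%N -> Z i `<` Z i.+1).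

(* The Krull dimension of T is n. *)
Definition has_dim (n : nat) : Prop :=
  forall m, irreducible_chain m <-> (m <= n)%N.

End Dimension.
Arguments has_dim : clear implicits.

(* Main.v *)
From HB Require Import structures.
Require Import Defs.
From mathcomp Require Import all_boot all_order all_algebra all_fingroup.
From mathcomp Require Import generic_quotient ring_quotient.
From mathcomp Require Import boolp classical_sets.
From mathcomp Require Import topology_structure connected.
From mathcomp Require Import mpoly.
Import GRing.Theory.

Set Implicit Arguments.
Unset Strict Implicit.
Unset Printing Implicit Defensive.

Local Open Scope classical_set_scope.
Local Open Scope ring_scope.

(** Full hiddenness says exactly that every face is an intersection of facets.
    The irreducible components of X are the coordinate subspaces spanned by the
    facets, and an automorphism phi permutes them, since it permutes the
    minimal primes P_F = (x_i : i notin F) of the reduced ring k[D]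
    ([component_exists]).  Because the empty face and the singletons are
    intersections of facets, this permutation of facets is induced by a
    permutation s of the vertices ([vertex_image]).  Because each face is an
    intersection of facets, the principal ideal (x_i) is the intersection of
    the P_F with i notin F ([div_x]); hence phi carries (x_i) onto (x_(s i)),
    and phi x_i = u x_(s i), where u is invertible on every component through
    s i.  Units of a polynomial ring are constants and the components through
    s i all meet in the origin, so u acts on x_(s i) as a single constant
    ([unit_on_star]).  Thus phi is a torus element times a symmetry of D
    ([aut_monomial]), which gives the semidirect product.

    As every automorphism is linear in the x_i, the first filtration piece is
    the whole group, and the matrix of phi on the span of the x_i embeds Aut(X)
    in GL_n.  The image is closed: it is the set of monomial matrices whose
    permutation pattern belongs to a symmetry of D.

    For the topology, Aut(X) is the finite disjoint union of closed cosets of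
    the torus, one per symmetry.  On a coset the n nonzero matrix entries are
    coordinates in which polynomial functions become Laurent polynomials
    ([coset_poly_polyfun]).  The subtori, given by setting some coordinates to
    1, are irreducible: two nonempty open subsets of a subtorus meet on the
    line through a point of each ([generic_point]).  They form a chain of
    length n, and the torus, being irreducible and clopen, is the identity
    component.

    The bound on the dimension is a growth argument that avoids transcendence
    degrees.  Given a chain Z_0 < ... < Z_m of irreducible closed sets, which
    lies in one coset, take f_j vanishing on Z_j but not on Z_(j+1).  The
    monomials in f_0, ..., f_(m-1) are linearly independent on Z_m
    ([free_on_powers]): modulo the last f they reduce to the previous stage,
    and the last f cancels by irreducibility.  With exponents below d there are
    d^m of them, inside a space of polynomials in n variables of dimension
    O(d^n), so m <= n ([prime_chain_length]). *)

(** * The Stanley-Reisner ring through its components *)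

Section MonomialSupport.
Context (k : fieldType) (n : nat) (D : complex n).
Local Notation A := (sr_ring k D).
Local Notation x := (xbar k D).

Definition mnm_supp (m : 'X_{1..n}) : {set 'I_n} := [set i | m i != 0%N]%SET.

Lemma mnm_supp0 : mnm_supp 0%MM = finset.set0.
Proof. by apply/setP => i; rewrite !inE mnm0E eqxx. Qed.

Lemma sr_pi_monomial m : sr_pi D 'X_[m] = \prod_i x i ^+ m i.
Proof.
rewrite mpolyXE_id rmorph_prod /=; apply: eq_bigr => i _.
by rewrite rmorphXn.
Qed.

Lemma sr_pi_nonface m : mnm_supp m \notin faces D -> sr_pi D ('X_[m] : {mpoly k[n]}) = 0.
Proof.
move=> mD; rewrite sr_pi_monomial (bigID (mem (mnm_supp m))) /=.
suff -> : \prod_(i in mnm_supp m) x i ^+ m i =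
    \prod_(i in mnm_supp m) x i * \prod_(i in mnm_supp m) x i ^+ (m i).-1.
  by rewrite prod_xbar // !mul0r.
rewrite -big_split /=; apply: eq_bigr => i; rewrite inE => mi.
by rewrite -exprS prednK // lt0n.
Qed.

Lemma sr_pi_sum (p : {mpoly k[n]}) :
  sr_pi D p = \sum_(m <- msupp p | mnm_supp m \in faces D) p@_m *: sr_pi D 'X_[m].
Proof.
rewrite [p in LHS]mpolyE rmorph_sum /= [LHS](bigID (fun m => mnm_supp m \in faces D)) /=.
rewrite [X in _ + X]big1 ?addr0 => [|m mD].
  by apply: eq_bigr => m _; rewrite linearZ.
by rewrite linearZ /= sr_pi_nonface // scaler0.
Qed.

(** The x_i generate k[D] as an algebra. *)
Lemma sr_lrmorph_eq (B : comAlgType k) (f g : {lrmorphism A -> B}) :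
  (forall i, f (x i) = g (x i)) -> f =1 g.
Proof.
move=> fg a; have [p ->] := sr_piP a.
elim/mpolyind: p => [|c m p _ _ IH]; first by rewrite !rmorph0.
rewrite !rmorphD /= IH; congr (_ + _).
rewrite !linearZ /=; congr (_ *: _).
rewrite sr_pi_monomial !rmorph_prod; apply: eq_bigr => i _.
by rewrite !rmorphXn /= fg.
Qed.

Definition face : Type := {S : {set 'I_n} | S \in faces D}.
HB.instance Definition _ := Finite.on face.

Definition face_var (S : {set 'I_n}) (i : 'I_n) : {mpoly k[n]} :=
  if i \in S then 'X_i else 0.

(** Restriction of a function on X to the coordinate subspace of the face [S],
    kept as a polynomial in all n variables so that the target does not depend
    on [S]. *)
Definition restr (S : face) (a : A) : {mpoly k[n]} :=
  mmap (@mpolyC n k) (face_var (sval S)) (repr a).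

Lemma mmap1_face_var S m :
  mmap1 (face_var S) m = if mnm_supp m \subset S then 'X_[m] else 0.
Proof.
rewrite /mmap1; case: ifPn => [mS|].
  rewrite mpolyXE_id; apply: eq_bigr => i _; rewrite /face_var.
  case: ifPn => // iS; have: i \notin mnm_supp m by apply: contra iS; apply/fintype.subsetP.
  by rewrite inE negbK => /eqP->; rewrite !expr0.
case/subsetPn => i; rewrite inE => mi iS.
by rewrite (bigD1 i) //= /face_var (negPf iS) expr0n (negPf mi) mul0r.
Qed.

Lemma mcoeff_face_var S p m :
  (mmap (@mpolyC n k) (face_var S) p)@_m = if mnm_supp m \subset S then p@_m else 0.
Proof.
elim/mpolyind: p => [|c m' p _ _ IH]; first by rewrite mmap0 !mcoeff0 if_same.
rewrite mmapD !mcoeffD {}IH mmapZ mmapX mmap1_face_var mcoeffCM mcoeffZ mcoeffX.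
case: (ifP (mnm_supp m \subset S)) => mS; case: ifP => m'S;
  rewrite ?mcoeffX ?mcoeff0 ?mulr0 ?addr0 ?add0r //.
  by case: eqP => [e|_]; [move: m'S; rewrite e mS|rewrite mulr0 add0r].
by case: eqP => [e|_]; [move: mS; rewrite -e m'S|rewrite mulr0].
Qed.

Lemma restr_pi S p : restr S (sr_pi D p) = mmap (@mpolyC n k) (face_var (sval S)) p.
Proof.
rewrite /restr; apply/eqP; rewrite -subr_eq0 -mmapB.
have : repr (sr_pi D p) - p \in sr_ideal D.
  by rewrite Quotient.idealrBE reprK.
move=> /asboolP[c ->]; rewrite raddf_sum /= big1 // => T TD.
rewrite rmorphM /= rmorph_prod /=.
have /subsetPn[i iT iS] : ~~ (T \subset sval S).
  by apply: contra TD => /face_sub; apply; apply: valP.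
by rewrite (bigD1 i) //= mmapX mmap1U /face_var (negPf iS) mul0r mulr0.
Qed.

(** On coefficients, restriction is a truncation; in particular the
    coefficients at monomials supported on faces do not depend on the chosen
    representative polynomial. *)
Lemma mcoeff_restr S p m :
  (restr S (sr_pi D p))@_m = if mnm_supp m \subset sval S then p@_m else 0.
Proof. by rewrite restr_pi mcoeff_face_var. Qed.

Lemma restr_zmod S : zmod_morphism (restr S).
Proof.
move=> a b; case: (sr_piP a) (sr_piP b) => [p ->] [r ->].
by rewrite -rmorphB !restr_pi rmorphB.
Qed.
Lemma restr_monoid S : monoid_morphism (restr S).
Proof.
split=> [|a b].
  by rewrite -[X in restr _ X](rmorph1 (@sr_pi k n D)) restr_pi rmorph1.
case: (sr_piP a) (sr_piP b) => [p ->] [r ->].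
by rewrite -rmorphM !restr_pi rmorphM.
Qed.
Lemma restr_scale S : scalable (restr S).
Proof.
move=> c a; case: (sr_piP a) => [p ->].
by rewrite -linearZ !restr_pi /= mmapZ mul_mpolyC.
Qed.
HB.instance Definition _ S := GRing.isZmodMorphism.Build A {mpoly k[n]} (restr S) (restr_zmod S).
HB.instance Definition _ S := GRing.isMonoidMorphism.Build A {mpoly k[n]} (restr S) (restr_monoid S).
HB.instance Definition _ S := GRing.isScalable.Build k A {mpoly k[n]} *:%R (restr S) (restr_scale S).

Lemma restr_x S i : restr S (x i) = if i \in sval S then 'X_i else 0.
Proof. by rewrite restr_pi mmapX mmap1U. Qed.

Lemma restr_sub (S T : face) a : sval S \subset sval T ->
  restr T a = 0 -> restr S a = 0.
Proof.
move=> ST; have [p ->] := sr_piP a; move/mpolyP => Ta; apply/mpolyP => m.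
move: (Ta m); rewrite !mcoeff_restr mcoeff0.
have [mS|//] := boolP (mnm_supp m \subset sval S); by rewrite (fintype.subset_trans mS ST).
Qed.

Definition is_facet (F : face) : bool := sval F \in facets D.

Lemma facet_over (S : {set 'I_n}) : S \in faces D ->
  exists2 F : face, is_facet F & S \subset sval F.
Proof.
move=> SD; have [F Fmax SF] := @maxset_exists _ (fun G => G \in faces D) S SD.
have FD : F \in faces D := maxsetp Fmax.
by exists (exist _ F FD) => //; rewrite /is_facet inE.
Qed.

Lemma facet_max (F G : face) : is_facet F -> sval F \subset sval G -> F = G.
Proof.
rewrite /is_facet inE => /maxsetP[_ Fmax] FG; apply/val_inj/esym.
by apply: Fmax => //; apply: valP.
Qed.

(** X is reduced and is the union of the subspaces of its facets: a monomial
    survives in k[D] only if its support is a face, and is then seen on any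
    facet containing that face. *)
Lemma restr_facet_inj a b : (forall F, is_facet F -> restr F a = restr F b) -> a = b.
Proof.
move=> ab; apply/eqP; rewrite -subr_eq0; have [p pE] := sr_piP (a - b).
rewrite pE sr_pi_sum big1_seq // => m /andP[mD _].
have [F Ff mF] := facet_over mD.
have : restr F (sr_pi D p) = 0 by rewrite -pE rmorphB /= ab // subrr.
by move=> /mpolyP/(_ m); rewrite mcoeff_restr mF mcoeff0 => ->; rewrite scale0r.
Qed.

End MonomialSupport.

(** * Automorphisms send variables to multiples of variables *)

Section MonomialAutomorphisms.
Context (k : fieldType) (n : nat) (D : complex n).
Local Notation A := (sr_ring k D).
Local Notation x := (xbar k D).
Local Notation aut := (sr_aut k D).
Local Notation restr := (@restr k n D).

Lemma mpolyX_neq0 i : ('X_i : {mpoly k[n]}) != 0.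
Proof. by rewrite -msize_poly_eq0 msizeX. Qed.

(** With P_F the kernel of restriction to F, this says phi(P_G) = P_F, that is,
    the map of X given by phi carries the component of F onto that of G. *)
Definition over_component (phi : aut) (G F : face D) : Prop :=
  forall a, (restr F (phi a) = 0) <-> (restr G a = 0).

(** Prime avoidance: otherwise some a_G vanishes on G for each facet G while
    phi a_G does not vanish on F.  The product of the a_G is zero, yet its image
    is nonzero on F because polynomials form a domain. *)
Lemma component_avoid (phi : aut) (F : face D) :
  exists2 G, is_facet G & forall a, restr G a = 0 -> restr F (phi a) = 0.
Proof.
apply: contrapT => noG.
have /choice[a aP] : forall G : face D, exists a, is_facet G ->
    restr G a = 0 /\ restr F (phi a) != 0.
  move=> G; apply: contrapT => noa; apply: noG.
  have [fG|nfG] := boolP (is_facet G); last by case: noa; exists 0 => /(negP nfG).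
  exists G => // a Ga; apply: contrapT => /eqP Fa.
  by apply: noa; exists a.
have a0 : \prod_(G : face D | is_facet G) a G = 0.
  apply: restr_facet_inj => G fG; rewrite rmorph_prod rmorph0.
  by rewrite (bigD1 G) //= (aP G fG).1 mul0r.
have /eqP := congr1 (restr F \o phi) a0.
rewrite /= !rmorph0 !rmorph_prod; apply/negP/prodf_neq0 => G fG.
by case: (aP G fG).
Qed.

Lemma over_component_inv phi G F :
  over_component phi G F -> over_component (aut_opp phi) F G.
Proof. by move=> GF a; rewrite -GF /= aut_invK. Qed.

(** Avoidance for phi and then for its inverse gives P_H in P_F, hence F in H;
    maximality of F closes the circle. *)
Lemma component_exists (phi : aut) F : is_facet F ->
  exists2 G, is_facet G & over_component phi G F.
Proof.
move=> fF; have [G fG GF] := component_avoid phi F; exists G => //.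
have [H fH HG] := component_avoid (aut_opp phi) G.
suff HF : F = H by move=> a; split=> [Fa|/GF//]; rewrite -(aut_funK phi a); apply: HG; rewrite -HF.
apply: facet_max => //; apply/fintype.subsetP => i; apply: contraTT => iH.
have := GF _ (HG (x i) _); rewrite restr_x (negPf iH) => /(_ erefl).
rewrite aut_invK restr_x; case: ifP => // _ /eqP.
by rewrite (negPf (mpolyX_neq0 i)).
Qed.

Lemma component_image (phi : aut) G : is_facet G ->
  exists2 F, is_facet F & over_component phi G F.
Proof.
move=> fG; have [F fF /over_component_inv FG] := component_exists (aut_opp phi) fG.
by exists F => // a; move: (FG a).
Qed.

Context (hD : fully_hidden D).

(** The form in which full hiddenness is used: every face is an intersection of
    facets. *)
Lemma face_closed (S : {set 'I_n}) j : S \in faces D -> j \notin S ->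
  exists F : face D, [/\ is_facet F, S \subset sval F & j \notin sval F].
Proof.
move=> SD jS; have [F fF SF] := facet_over SD.
move/forallP: hD => /(_ (sval F))/implyP/(_ fF).
rewrite /hidden negb_exists => /forallP/(_ j).
rewrite negb_exists => /forallP/(_ S); rewrite SF andbT inE SD jS /=.
rewrite /cl => jcl; apply: contrapT => noF; case/negP: jcl.
apply/bigcapP => G; rewrite inE => /andP[fG SG]; apply: contrapT => /negP jG.
have GD : G \in faces D by move: fG; rewrite inE => /maxsetp.
by apply: noF; exists (exist _ G GD).
Qed.

Definition origin : face D := exist (fun S => S \in faces D) _ (face0 D).
Definition vertex i : face D := exist (fun S => S \in faces D) _ (face1 D i).

(** The facets have empty intersection, so x_i vanishes on some component; then
    phi x_i vanishes on the corresponding component, which contains the origin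
    as every component does. *)
Lemma aut_fixes_origin (phi : aut) i : restr origin (phi (x i)) = 0.
Proof.
have [|F [fF _ iF]] := face_closed (face0 D) (j := i); first by rewrite inE.
have [G fG GF] := component_image phi fF.
apply: (@restr_sub _ _ _ _ G); first by apply: finset.sub0set.
by apply/GF; rewrite restr_x (negPf iF).
Qed.

Lemma restr_vertex_const (psi : aut) i :
  (forall j, restr (vertex i) (psi (x j)) = 0) ->
  forall a, restr (vertex i) (psi a) = restr origin a.
Proof.
move=> psi0; apply: (sr_lrmorph_eq (f := restr (vertex i) \o psi) (g := restr origin)) => j /=.
by rewrite psi0 restr_x inE.
Qed.

(** If no vertex lies in all the images of the facets through i, each x_j
    vanishes on one of these images, so its preimage under phi vanishes on the
    line of i.  Then the preimage of phi x_i is constant on that line, although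
    it is the coordinate x_i. *)
Lemma vertex_image_sub (phi : aut) i : exists j, forall F G,
  is_facet F -> is_facet G -> over_component phi G F ->
  i \in sval G -> j \in sval F.
Proof.
apply: contrapT => noj.
suff psi0 j : restr (vertex i) (aut_inv phi (x j)) = 0.
  have := restr_vertex_const (psi := aut_opp phi) psi0 (phi (x i)).
  rewrite /= aut_funK aut_fixes_origin restr_x inE eqxx => /eqP.
  by rewrite (negPf (mpolyX_neq0 i)).
apply: contrapT => psij; apply: noj; exists j => F G fF fG GF iG.
apply: contrapT => /negP jF; apply: psij.
apply: (@restr_sub _ _ _ _ G); first by rewrite finset.sub1set.
by apply/GF; rewrite aut_invK restr_x (negPf jF).
Qed.

(** Applying the previous lemma to phi and to its inverse produces a vertex i'
    lying in every facet through i; it is i because singletons are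
    intersections of facets. *)
Lemma vertex_image (phi : aut) i : exists j, forall F G,
  is_facet F -> is_facet G -> over_component phi G F ->
  (i \in sval G) = (j \in sval F).
Proof.
have [j ij] := vertex_image_sub phi i; exists j => F G fF fG GF.
apply/idP/idP; first exact: ij.
have [i' ji'] := vertex_image_sub (aut_opp phi) j.
suff -> : i = i' by move/ji'; apply=> //; apply: over_component_inv.
apply/esym; apply: contrapT => /eqP i'i.
have [|H [fH iH i'H]] := face_closed (face1 D i) (j := i'); first by rewrite inE.
have [H' fH' HH'] := component_image phi fH.
case/negP: i'H; apply: (ji' H H') => //; first exact: over_component_inv.
by apply: (ij _ H) => //; apply: (fintype.subsetP iH); rewrite inE.
Qed.

(** The ideal (x_j) is the intersection of the P_F with j notin F: a monomial
    supported on a face S missing j is detected by a facet that contains S and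
    misses j. *)
Lemma div_x j a :
  (forall F : face D, is_facet F -> j \notin sval F -> restr F a = 0) ->
  exists u, a = u * x j.
Proof.
have [p ->] := sr_piP a => p0.
exists (\sum_(m <- msupp p | mnm_supp m \in faces D) p@_m *: sr_pi D 'X_[m - U_(j)]).
rewrite sr_pi_sum mulr_suml big_seq_cond [RHS]big_seq_cond.
apply: eq_bigr => m /andP[pm mD].
have jm : (0 < m j)%N.
  rewrite lt0n; apply: contraTT pm => jm0.
  have [|F [fF mF jF]] := face_closed mD (j := j); first by rewrite inE.
  by rewrite mcoeff_msupp negbK -(mcoeff0 k m) -(p0 F fF jF) mcoeff_restr mF.
rewrite -scalerAl -(rmorphM (@sr_pi k n D)) -mpolyXD submK //.
by apply/mnm_lepP => l; rewrite mnm1E; case: eqP => // <-.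
Qed.

Lemma restr_origin S a : (restr S a)@_0%MM = (restr origin a)@_0%MM.
Proof. by have [p ->] := sr_piP a; rewrite !mcoeff_restr mnm_supp0 !finset.sub0set. Qed.

Lemma mpoly_unit_const (p q : {mpoly k[n]}) : p * q = 1 -> q = (q@_0%MM)%:MP.
Proof. by move/mpoly_intro_unit => /andP[/eqP]. Qed.

(** On each component through j, [u] restricts to a unit of a polynomial ring,
    hence to a constant; the constant is the value at the origin, the same for
    all components.  On the other components x_j vanishes. *)
Lemma unit_on_star u v j : v * u * x j = x j -> exists2 c, c != 0 & u * x j = c *: x j.
Proof.
move=> vu; exists (restr origin u)@_0%MM; last first.
  apply: restr_facet_inj => F fF; rewrite rmorphM linearZ /= restr_x.
  case: ifP => jF; last by rewrite mulr0 scaler0.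
  have := congr1 (restr F) vu; rewrite !rmorphM /= restr_x jF => /eqP.
  rewrite -{2}['X_j]mul1r -subr_eq0 -mulrBl mulf_eq0 (negPf (mpolyX_neq0 j)) orbF.
  by rewrite subr_eq0 => /eqP/mpoly_unit_const->; rewrite restr_origin mul_mpolyC.
have := congr1 (restr (vertex j)) vu; rewrite !rmorphM /= restr_x inE eqxx => /eqP.
rewrite -{2}['X_j]mul1r -subr_eq0 -mulrBl mulf_eq0 (negPf (mpolyX_neq0 j)) orbF subr_eq0.
move=> /eqP/(congr1 (mcoeff 0%MM)); rewrite rmorphM /= mcoeff1 eqxx !restr_origin.
by move=> vu1; apply/eqP => u0; move/eqP: vu1; rewrite u0 mulr0 eq_sym oner_eq0.
Qed.

Lemma aut_monomial_vertex (phi : aut) i j : (forall F G,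
    is_facet F -> is_facet G -> over_component phi G F ->
    (i \in sval G) = (j \in sval F)) ->
  exists2 c, c != 0 & phi (x i) = c *: x j.
Proof.
move=> ij; have [u uE] : exists u, phi (x i) = u * x j.
  apply: div_x => F fF jF; have [G fG GF] := component_exists phi fF.
  by apply/GF; rewrite restr_x (ij F G) // (negPf jF).
have [v vE] : exists v, aut_inv phi (x j) = v * x i.
  apply: div_x => G fG iG; have [F fF GF] := component_image phi fG.
  by apply/GF; rewrite aut_invK restr_x -(ij F G) // (negPf iG).
rewrite uE; apply: (@unit_on_star _ (phi v)).
by rewrite -mulrA -uE -rmorphM /= -vE aut_invK.
Qed.

(** Preserving faces in one direction suffices, since there are finitely many. *)
Lemma mem_sym_complex (s : 'S_n) :
  (forall S : {set 'I_n}, S \in faces D -> [set s i | i in S]%SET \in faces D) ->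
  s \in sym_complex D.
Proof.
move=> sD; rewrite inE eqEcard; apply/andP; split.
  by apply/fintype.subsetP => _ /finset.imsetP[S SD ->]; apply: sD.
by rewrite card_imset //; apply: imset_inj; apply: perm_inj.
Qed.

Lemma aut_monomial (phi : aut) : exists (t : torus k n) (s : symm D),
  forall i, phi (x i) = tcoord t i *: x (sval s i).
Proof.
have /choice[s sP] := vertex_image phi.
have /choice[t tP] : forall i, exists c, c != 0 /\ phi (x i) = c *: x (s i).
  by move=> i; have [c c0 E] := aut_monomial_vertex (sP i); exists c.
have s_inj : injective s.
  move=> i j sij; apply/esym; apply: contrapT => /eqP ji.
  have [|G [fG iG jG]] := face_closed (face1 D i) (j := j); first by rewrite inE.
  have [F fF GF] := component_image phi fG.
  case/negP: jG; rewrite (sP j F G) // -sij -(sP i F G) //.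
  by apply: (fintype.subsetP iG); rewrite inE.
have sD : perm s_inj \in sym_complex D.
  apply: mem_sym_complex => S SD.
  have [G fG SG] := facet_over SD; have [F fF GF] := component_image phi fG.
  apply: face_sub (valP F); apply/fintype.subsetP => _ /finset.imsetP[i iS ->].
  by rewrite permE -(sP i F G) // (fintype.subsetP SG).
exists (mk_torus (fun i => (tP i).1)), (exist (fun s => s \in sym_complex D) _ sD) => i /=.
by rewrite mk_torusE permE (tP i).2.
Qed.

End MonomialAutomorphisms.

(** * The semidirect decomposition and the linear representation *)

Section Subgroups.
Context (k : fieldType) (n : nat) (D : complex n).
Local Notation A := (sr_ring k D).
Local Notation x := (xbar k D).
Local Notation aut := (sr_aut k D).

Definition coefx (i : 'I_n) (a : A) : k := (restr (vertex D i) a)@_U_(i)%MM.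

Lemma coefx_linear i : linear_for *%R (coefx i).
Proof. by move=> c a b; rewrite /coefx linearP mcoeffD mcoeffZ. Qed.
HB.instance Definition _ i := GRing.isLinear.Build k A k _ (coefx i) (coefx_linear i).

Lemma coefxZx i c j : coefx i (c *: x j) = if i == j then c else 0.
Proof.
rewrite /coefx linearZ /= mcoeffZ restr_x inE eq_sym; case: eqP => [->|_].
  by rewrite mcoeffXU eqxx mulr1.
by rewrite mcoeff0 mulr0.
Qed.

Lemma coefx_x i j : coefx i (x j) = (i == j)%:R.
Proof. by rewrite -[x j]scale1r coefxZx; case: eqP. Qed.

Lemma aut_ext (f g : aut) : (forall i, f (x i) = g (x i)) -> f = g.
Proof. by move=> fg; apply: sr_aut_eq; apply: sr_lrmorph_eq. Qed.

Lemma aut_mulE (f g : aut) a : (f * g)%g a = f (g a). Proof. by []. Qed.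
Lemma aut_invE (f : aut) a : (f^-1)%g a = aut_inv f a. Proof. by []. Qed.
Lemma aut_oneE a : (1%g : aut) a = a. Proof. by []. Qed.

Lemma torus_aut_inj : injective (@torus_aut k n D).
Proof.
move=> s t st; apply: torus_eq => i.
have := congr1 (fun f : aut => coefx i (f (x i))) st.
by rewrite !torus_autE !coefxZx eqxx.
Qed.

Lemma torus_autM (s t : torus k n) :
  torus_aut D (s * t)%g = (torus_aut D s * torus_aut D t)%g.
Proof.
apply: aut_ext => i; rewrite aut_mulE !torus_autE linearZ /= torus_autE scalerA.
by rewrite mk_torusE mulrC.
Qed.

Lemma torus_autV (t : torus k n) : torus_aut D (t^-1)%g = ((torus_aut D t)^-1)%g.
Proof. by apply: aut_ext => i; rewrite !torus_autE. Qed.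

Lemma symm_aut_inj : injective (@symm_aut k n D).
Proof.
move=> s t st; apply/val_inj/permP => i.
have := congr1 (fun f : aut => coefx (val s i) (f (x i))) st.
rewrite !symm_autE !coefx_x eqxx; case: eqP => // _ /eqP.
by rewrite oner_eq0.
Qed.

Lemma symm_autM (s t u : symm D) : (forall i, sval u i = sval s (sval t i)) ->
  symm_aut k u = (symm_aut k s * symm_aut k t)%g.
Proof. by move=> ust; apply: aut_ext => i; rewrite aut_mulE !symm_autE ust. Qed.

Definition mk_symm (s : 'S_n) (sD : s \in sym_complex D) : symm D :=
  exist (fun s => s \in sym_complex D) s sD.

Lemma sym_complexM (s t : 'S_n) : s \in sym_complex D -> t \in sym_complex D ->
  (s * t)%g \in sym_complex D.
Proof.
move=> sD tD; apply: mem_sym_complex => S SD.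
have -> : [set (s * t)%g i | i in S]%SET = [set t i | i in [set s i | i in S]]%SET.
  by rewrite -finset.imset_comp; apply: eq_imset => i /=; rewrite permM.
by rewrite !symm_face.
Qed.

Lemma symm_autV (s : symm D) :
  symm_aut k (mk_symm (symm_inv (valP s))) = ((symm_aut k s)^-1)%g.
Proof. by apply: aut_ext => i; rewrite symm_autE; apply/esym/sr_lift_x. Qed.

Lemma symm1 : (1%g : 'S_n) \in sym_complex D.
Proof.
apply: mem_sym_complex => S; rewrite (@eq_imset _ _ _ id) ?imset_id //.
by move=> i; rewrite perm1.
Qed.

Context (hD : fully_hidden D).

Lemma aut_semidirect :
  internal_semidirect (range (@torus_aut k n D)) (range (@symm_aut k n D)).
Proof.
split.
- split; first by exists 1%g => //; apply: aut_ext => i; rewrite torus_autE mk_torusE scale1r.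
  by move=> _ _ [s _ <-] [t _ <-]; exists (s * t^-1)%g => //; rewrite torus_autM torus_autV.
- split.
    by exists (mk_symm symm1) => //; apply: aut_ext => i; rewrite symm_autE perm1.
  move=> _ _ [s _ <-] [t _ <-].
  exists (mk_symm (sym_complexM (symm_inv (valP t)) (valP s))) => //.
  by rewrite -symm_autV; apply: symm_autM => i /=; rewrite permM.
- move=> g _ [a _ <-]; have [t [s gV]] := aut_monomial hD (g^-1)%g.
  have a0 i : tcoord a (sval s i) != 0 by apply: tcoord_neq0.
  exists (mk_torus a0) => //; apply: aut_ext => i.
  rewrite torus_autE mk_torusE !aut_mulE gV linearZ /= torus_autE.
  by rewrite scalerA mulrC -scalerA linearZ /= -gV aut_invE aut_invK.
- apply/seteqP; split=> [f [[t _ <-] [s _ st]]|_ ->]; last first.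
    split; first by exists 1%g => //; apply: aut_ext => i; rewrite torus_autE mk_torusE scale1r.
    by exists (mk_symm symm1) => //; apply: aut_ext => i; rewrite symm_autE perm1.
  apply: aut_ext => i; rewrite -st symm_autE.
  have := congr1 (fun f : aut => coefx (sval s i) (f (x i))) st.
  rewrite symm_autE torus_autE coefxZx coefx_x eqxx; case: eqP => [->//|_ /eqP].
  by rewrite oner_eq0.
- move=> g; have [t [s gE]] := aut_monomial hD g.
  have t0 i : tcoord t ((sval s)^-1%g i) != 0 by apply: tcoord_neq0.
  exists (torus_aut D (mk_torus t0)); first by exists (mk_torus t0).
  exists (symm_aut k s); first by exists s.
  by apply: aut_ext => i; rewrite aut_mulE symm_autE torus_autE mk_torusE permK.
Qed.

(** The matrix, on the span of the x_i, of the linear part of [f]; by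
    [autmx_sum] it determines [f]. *)
Definition autmx (f : aut) : 'M[k]_n := \matrix_(i, j) coefx i (f (x j)).

Lemma autmx_sum (f : aut) j : f (x j) = \sum_i autmx f i j *: x i.
Proof.
have [t [s fE]] := aut_monomial hD f.
rewrite (bigD1 (sval s j)) //= mxE fE coefxZx eqxx big1 ?addr0 // => i ij.
by rewrite mxE fE coefxZx (negPf ij) scale0r.
Qed.

Lemma autmxM (f g : aut) : autmx (f * g)%g = autmx f *m autmx g.
Proof.
apply/matrixP => i j; rewrite !mxE aut_mulE (autmx_sum g j) !linear_sum.
by apply: eq_bigr => l _; rewrite !linearZ /= !mxE mulrC.
Qed.

Lemma autmx1 : autmx 1%g = 1%:M.
Proof. by apply/matrixP => i j; rewrite !mxE aut_oneE coefx_x. Qed.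

Lemma autmxV (f : aut) : autmx f *m autmx (f^-1)%g = 1%:M.
Proof. by rewrite -autmxM mulgV autmx1. Qed.

Lemma autmx_unit (f : aut) : autmx f \in unitmx.
Proof. by have /mulmx1_unit[] := autmxV f. Qed.

Lemma autmx_inv (f : aut) : autmx (f^-1)%g = invmx (autmx f).
Proof. by rewrite -[LHS](mulKmx (autmx_unit f)) autmxV mulmx1. Qed.

Lemma autmx_inj : injective autmx.
Proof. by move=> f g fg; apply: aut_ext => j; rewrite !autmx_sum fg. Qed.

End Subgroups.

(** * Closure properties of polynomial functions *)

Section PolynomialFunctionClosure.
Context (k : fieldType) (V : lmodType k).

Lemma polyfun_lin (f : V -> k) : linear_for *%R f -> polyfun f.
Proof.
move=> fl; pose l : {scalar V} := HB.pack f (GRing.isLinear.Build k V k _ f fl).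
exact: (polyfun_linear l).
Qed.

Lemma polyfun_sum (I : Type) (r : seq I) (P : pred I) (F : I -> V -> k) :
  (forall i, polyfun (F i)) -> polyfun (fun v => \sum_(i <- r | P i) F i v).
Proof.
move=> Fp; elim: r => [|i r IH].
  by under eq_fun do rewrite big_nil; apply: polyfun_const.
under eq_fun do rewrite big_cons; case: (P i) => //.
exact: polyfun_add.
Qed.

Lemma polyfun_prod (I : Type) (r : seq I) (P : pred I) (F : I -> V -> k) :
  (forall i, polyfun (F i)) -> polyfun (fun v => \prod_(i <- r | P i) F i v).
Proof.
move=> Fp; elim: r => [|i r IH].
  by under eq_fun do rewrite big_nil; apply: polyfun_const.
under eq_fun do rewrite big_cons; case: (P i) => //.
exact: polyfun_mul.
Qed.

Lemma polyfun_exp (f : V -> k) m : polyfun f -> polyfun (fun v => f v ^+ m).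
Proof.
move=> fp; elim: m => [|m IH]; first by under eq_fun do rewrite expr0; apply: polyfun_const.
by under eq_fun do rewrite exprS; apply: polyfun_mul.
Qed.

Lemma polyfun_det N (M : V -> 'M[k]_N) :
  (forall i j, polyfun (fun v => M v i j)) -> polyfun (fun v => \det (M v)).
Proof.
move=> Mp; apply: polyfun_sum => s; apply: polyfun_mul; first exact: polyfun_const.
by apply: polyfun_prod => i.
Qed.

Lemma polyfun_adj N (M : V -> 'M[k]_N) :
  (forall i j, polyfun (fun v => M v i j)) ->
  forall i j, polyfun (fun v => (\adj (M v)) i j).
Proof.
move=> Mp i j; under eq_fun do rewrite mxE.
apply: polyfun_mul; first exact: polyfun_const.
by apply: polyfun_det => i' j'; under eq_fun do rewrite !mxE.
Qed.

Lemma polyfun_mpoly n (q : 'I_n -> V -> k) (p : {mpoly k[n]}) :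
  (forall i, polyfun (q i)) -> polyfun (fun v => p.@[fun i => q i v]).
Proof.
move=> qp; under eq_fun do rewrite mevalE.
apply: polyfun_sum => m; apply: polyfun_mul; first exact: polyfun_const.
by apply: polyfun_prod => i; apply: polyfun_exp.
Qed.

End PolynomialFunctionClosure.

(** * Aut(X) as a closed subgroup of GL_n *)

Section MatrixRepresentation.
Context (k : fieldType) (n : nat) (D : complex n) (hD : fully_hidden D).
Local Notation A := (sr_ring k D).
Local Notation x := (xbar k D).
Local Notation aut := (sr_aut k D).
Local Notation V := (ind_ambient k D).

(** The filtration is stationary from degree 1 on, because automorphisms are
    linear in the variables. *)
Lemma ind_piece1 (f : aut) : ind_piece 1 f.
Proof.
have deg1 (g : aut) l : deg_le 1 (g (x l)).
  have [t [s gE]] := aut_monomial hD g; rewrite gE.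
  exists (tcoord t l *: 'X_(sval s l)); last by rewrite linearZ.
  by apply: leq_trans (msizeZ_le _ _) _; rewrite msizeX mdeg1.
by move=> l; split; [apply: deg1|apply: (deg1 (f^-1)%g)].
Qed.

Definition fst_coord i j (v : V) : k := coefx i (v.1 j).

Lemma polyfun_fst_coord i j : polyfun (fst_coord i j).
Proof.
by apply: polyfun_lin => c u v; rewrite /fst_coord /= !ffunE linearP.
Qed.

Lemma fst_coordE i j f : fst_coord i j (ind_coord f) = autmx f i j.
Proof. by rewrite /fst_coord ffunE mxE. Qed.

Definition fst_basis i j : V := ([ffun l => if l == j then x i else 0], 0).
Definition snd_basis i j : V := (0, [ffun l => if l == j then x i else 0]).

(** The point of the ambient space attached to [f] depends linearly on the
    entries of the matrices of [f] and of its inverse, so that polynomial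
    functions of the former are polynomials in the latter. *)
Lemma ind_coord_sum (f : aut) :
  ind_coord f = \sum_j \sum_i autmx f i j *: fst_basis i j
              + \sum_j \sum_i autmx (f^-1)%g i j *: snd_basis i j.
Proof.
have colE (g : aut) l : \sum_j \sum_i
    (autmx g i j *: ([ffun l' => if l' == j then x i else 0] : {ffun 'I_n -> A})) l = g (x l).
  rewrite (bigD1 l) //= [X in _ + X]big1 ?addr0 => [|j jl].
    by rewrite (autmx_sum hD g l); apply: eq_bigr => i _; rewrite !ffunE eqxx.
  by rewrite big1 // => i _; rewrite !ffunE eq_sym (negPf jl) scaler0.
have sumE (g : aut) : \sum_j \sum_i
    (autmx g i j *: ([ffun l' => if l' == j then x i else 0] : {ffun 'I_n -> A})) = [ffun l => g (x l)].
  apply/ffunP => l; rewrite sum_ffunE ffunE -colE; apply: eq_bigr => j _.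
  by rewrite sum_ffunE.
rewrite /ind_coord -sumE.
have -> : [ffun l => aut_inv f (x l)] = [ffun l => (f^-1)%g (x l)] by [].
rewrite -sumE.
have e1 : \sum_j \sum_i autmx f i j *: fst_basis i j =
    (\sum_j \sum_i autmx f i j *: [ffun l' => if l' == j then x i else 0], 0).
  apply: injective_projections; rewrite /= raddf_sum.
    by apply: eq_bigr => j _; rewrite raddf_sum.
  by rewrite big1 // => j _; rewrite raddf_sum big1 // => i _ /=; rewrite scaler0.
have e2 : \sum_j \sum_i autmx (f^-1)%g i j *: snd_basis i j =
    (0, \sum_j \sum_i autmx (f^-1)%g i j *: [ffun l' => if l' == j then x i else 0]).
  apply: injective_projections; rewrite /= raddf_sum.
    by rewrite big1 // => j _; rewrite raddf_sum big1 // => i _ /=; rewrite scaler0.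
  by apply: eq_bigr => j _; rewrite raddf_sum.
by rewrite e1 e2; apply: injective_projections; rewrite /= ?addr0 ?add0r.
Qed.

(** The equations say that each column has at most one nonzero entry and that
    no permutation outside the symmetries of D contributes to the determinant.
    For an invertible matrix some permutation contributes, and it is then the
    position pattern of the nonzero entries. *)
Lemma range_autmx_closed :
  zclosed_in (@gl_coord k n) (@gl k n) (range (@autmx k n D)).
Proof.
have entryp i j : polyfun (fun v : 'M[k]_n * k^o => v.1 i j).
  by apply: polyfun_lin => c u v; rewrite !mxE.
exists [set h | (exists i i' j, i != i' /\ h = fun v : 'M[k]_n * k^o => v.1 i j * v.1 i' j) \/
    (exists2 s : 'S_n, s \notin sym_complex D & h = fun v : 'M[k]_n * k^o => \prod_i v.1 i (s i))].
  move=> _ [[i [i' [j [_ ->]]]]|[s _ ->]]; first exact: polyfun_mul.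
  by apply: polyfun_prod => i.
apply/seteqP; split=> M [glM]; last first.
  move=> M0; split=> //.
  have Mcol i i' j : i != i' -> M i j * M i' j = 0.
    by move=> ii'; apply: (M0 (fun v : 'M[k]_n * k^o => v.1 i j * v.1 i' j)); left; exists i, i', j.
  have Msym (s : 'S_n) : s \notin sym_complex D -> \prod_i M i (s i) = 0.
    by move=> sD; apply: (M0 (fun v : 'M[k]_n * k^o => \prod_i v.1 i (s i))); right; exists s.
  (* The Leibniz formula of a nonzero determinant has a nonzero term. *)
  have [s sM] : exists s : 'S_n, \prod_i M i (s i) != 0.
    apply: contrapT => nos; move: glM; rewrite /gl /= unitmxE unitfE => /eqP; apply.
    rewrite /determinant big1 // => s _; apply/eqP; rewrite mulf_eq0; apply/orP; right.
    by apply: contrapT => /negP sM; apply: nos; exists s.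
  have sD : s \in sym_complex D by apply: contraNT sM => /Msym ->.
  have Ms i : M i (s i) != 0.
    by apply: contraNneq sM => Mi; rewrite (bigD1 i) //= Mi mul0r.
  exists (torus_aut D (mk_torus Ms) * symm_aut k (mk_symm (symm_inv sD)))%g => //.
  apply/matrixP => i j; rewrite mxE aut_mulE symm_autE torus_autE mk_torusE /=.
  rewrite coefxZx permKV; case: eqP => [->//|/eqP ij].
  have /eqP := Mcol _ _ j ij; rewrite mulf_eq0 => /orP[/eqP->//|].
  by rewrite -{2}[j](permKV s) (negPf (Ms _)).
move=> [f _ fM]; split=> // h; have [t [s fE]] := aut_monomial hD f.
have ME i j : M i j = if i == sval s j then tcoord t j else 0.
  by rewrite -fM mxE fE coefxZx.
case=> [[i [i' [j [ii' ->]]]]|[u uD ->]] /=.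
  rewrite !ME; case: eqP => [e|_]; last by rewrite mul0r.
  by rewrite -e eq_sym (negPf ii') mulr0.
apply/eqP/prodf_eq0; apply: contrapT => noi; case/negP: uD.
suff -> : u = ((sval s)^-1)%g by apply: symm_inv (valP s).
apply/permP => i; apply: (@perm_inj _ (sval s)); rewrite permKV.
apply: contrapT => /eqP si; apply: noi; exists i => //.
by rewrite ME [i == _]eq_sym (negPf si).
Qed.

Lemma aut_linear_algebraic : linear_algebraic_aut k D.
Proof.
exists n, (@autmx k n D); split.
- by split; [apply: autmx_unit|apply: autmxM|apply: autmx_inj].
- exact: range_autmx_closed.
- move=> d i j; exists (fst_coord i j); first exact: polyfun_fst_coord.
  by move=> f _; rewrite fst_coordE.
exists 1%N; first exact: ind_piece1.
move=> l; exists (fun v : 'M[k]_n * k^o =>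
  \sum_j \sum_i v.1 i j * l (fst_basis i j)
  + \sum_j \sum_i v.2 * (\adj v.1) i j * l (snd_basis i j)).
  have entryp i j : polyfun (fun v : 'M[k]_n * k^o => v.1 i j).
    by apply: polyfun_lin => c u v; rewrite !mxE.
  apply: polyfun_add; apply: polyfun_sum => j; apply: polyfun_sum => i;
    apply: polyfun_mul; try exact: polyfun_const; first exact: entryp.
  apply: polyfun_mul; first by apply: polyfun_lin.
  exact: polyfun_adj.
move=> f; rewrite ind_coord_sum linearD !linear_sum /=; congr (_ + _);
  apply: eq_bigr => j _; rewrite linear_sum; apply: eq_bigr => i _.
  by rewrite linearZ.
by rewrite linearZ /= autmx_inv // /invmx autmx_unit // mxE.
Qed.

End MatrixRepresentation.

Lemma leq_exp2n a b n : (a <= b -> a ^ n <= b ^ n)%N.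
Proof. by move=> ab; elim: n => // n IH; rewrite !expnS leq_mul. Qed.

(** * A growth bound for chains of irreducible sets *)

Section GrowthBound.
Context (k : fieldType) (n : nat).

Lemma msizeM_deg (p q : {mpoly k[n]}) a b :
  (msize p <= a.+1)%N -> (msize q <= b.+1)%N -> (msize (p * q) <= (a + b).+1)%N.
Proof.
move=> pa qb; have [->|p0] := eqVneq p 0; first by rewrite mul0r msize0.
have [->|q0] := eqVneq q 0; first by rewrite mulr0 msize0.
rewrite msizeM //; apply: (@leq_trans (a.+1 + b.+1).-1); last by rewrite addnS.
by rewrite -!subn1 leq_sub2r // leq_add.
Qed.

Lemma msizeX_deg (p : {mpoly k[n]}) a e :
  (msize p <= a.+1)%N -> (msize (p ^+ e) <= (e * a).+1)%N.
Proof.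
move=> pa; elim: e => [|e IH]; first by rewrite expr0 msize1.
by rewrite exprS mulSn; apply: msizeM_deg.
Qed.

(** Polynomials of total degree at most M have all their exponents at most M,
    so they span a space of dimension at most (M + 1)^n. *)
Lemma free_family_card (I : finType) (g : I -> {mpoly k[n]}) M :
  (forall i, (msize (g i) <= M.+1)%N) ->
  (forall c : I -> k, \sum_i c i *: g i = 0 -> forall i, c i = 0) ->
  (#|I| <= M.+1 ^ n)%N.
Proof.
move=> gM gfree; pose J := {ffun 'I_n -> 'I_M.+1}.
have -> : (M.+1 ^ n)%N = #|J| by rewrite card_ffun !card_ord.
pose mon (b : J) : 'X_{1..n} := [multinom (b i : nat) | i < n].
pose B : 'M[k]_(#|I|, #|J|) :=
  \matrix_(i, j) (g (enum_val i))@_(mon (enum_val j)).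
suff /eqP <- : row_free B by apply: rank_leq_col.
apply/row_freeP; apply: contrapT => nB.
have [u uB u0] : exists2 u : 'rV_#|I|, u *m B = 0 & u != 0.
  have : kermx B != 0 by rewrite kermx_eq0; apply/negP => /row_freeP.
  case/rowV0Pn => u /sub_kermxP; by exists u.
case/negP: u0; apply/eqP/rowP => i; rewrite mxE -[i]enum_valK.
move: (enum_val i) => {}i.
apply: (gfree (fun i => u 0 (enum_rank i))); apply/mpolyP => m.
rewrite raddf_sum /= mcoeff0.
have [mM|mM] := boolP [forall j, (m j < M.+1)%N].
  pose b : J := [ffun j => Ordinal (forallP mM j)].
  have mb : m = mon b by apply/mnmP => j; rewrite mnmE ffunE.
  have := congr1 (fun v : 'rV_ _ => v 0 (enum_rank b)) uB; rewrite !mxE => uB0; rewrite -[RHS]uB0.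
  rewrite (reindex enum_rank) /=; last by apply: onW_bij; apply: enum_rank_bij.
  by apply: eq_bigr => l _; rewrite mcoeffZ mxE !enum_rankK mb.
rewrite big1 // => l _; rewrite mcoeffZ memN_msupp_eq0 ?mulr0 //.
apply: msize_mdeg_ge; apply: leq_trans (gM l) _.
move: mM; rewrite negb_forall => /existsP[j]; rewrite -leqNgt => /leq_trans; apply.
by rewrite mdegE (bigD1 j) //= leq_addr.
Qed.

Context (T : Type) (t : T -> 'I_n -> k).

(** The polynomials in the coordinates [t] that vanish on [Z] form a prime ideal
    or the whole ring. *)
Definition prime_on (Z : set T) : Prop := forall p q : {mpoly k[n]},
  (forall z, Z z -> (p * q).@[t z] = 0) ->
  (forall z, Z z -> p.@[t z] = 0) \/ (forall z, Z z -> q.@[t z] = 0).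

Definition free_on (I : finType) (g : I -> {mpoly k[n]}) (Z : set T) : Prop :=
  forall c : I -> k, (forall z, Z z -> (\sum_i c i *: g i).@[t z] = 0) ->
    forall i, c i = 0.

(** A relation among the g_i f^j on [Z] restricts on [Z'], where f = 0, to a
    relation among the g_i; so its terms with j = 0 vanish.  The rest is f times
    a shorter relation, and f cancels because the ideal of [Z] is prime. *)
Lemma free_on_powers (I : finType) (g : I -> {mpoly k[n]}) (Z Z' : set T) f d :
  Z' `<=` Z -> prime_on Z -> (forall z, Z' z -> f.@[t z] = 0) ->
  (exists2 z, Z z & f.@[t z] != 0) -> free_on g Z' ->
  free_on (fun a : I * 'I_d => g a.1 * f ^+ a.2) Z.
Proof.
move=> Z'Z Zprime fZ' [z0 Zz0 fz0] gfree.
suff powers e (c : nat -> I -> k) :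
    (forall z, Z z -> (\sum_(j < e) (\sum_i c j i *: g i) * f ^+ j).@[t z] = 0) ->
    forall j, (j < e)%N -> forall i, c j i = 0.
  move=> c cZ [i j]; pose c' (j : nat) i := oapp (fun j => c (i, j)) 0 (insub j).
  suff cE z : (\sum_(l < d) (\sum_i c' l i *: g i) * f ^+ l).@[t z] =
      (\sum_a c a *: (g a.1 * f ^+ a.2)).@[t z].
    rewrite -[LHS](_ : c' j i = _); last by rewrite /c' valK.
    by apply: (powers d) => // z Zz; rewrite cE cZ.
  have -> : \sum_a c a *: (g a.1 * f ^+ a.2) =
      \sum_i \sum_(l < d) c (i, l) *: (g i * f ^+ l).
    by rewrite pair_bigA; apply: eq_bigr => -[].
  congr (_.@[_]).
  rewrite exchange_big /=; apply: eq_bigr => l _; rewrite mulr_suml.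
  by apply: eq_bigr => a _; rewrite /c' valK -scalerAl.
elim: e c => [|e IH] c cZ //.
have c0 i : c 0%N i = 0.
  apply: gfree i => z Z'z; rewrite -[RHS](cZ z (Z'Z z Z'z)) big_ord_recl expr0 mulr1.
  set s := \sum_(j < e) _; suff s0 : s.@[t z] = 0 by rewrite mevalD s0 addr0.
  rewrite /s raddf_sum /= big1 // => j _.
  by rewrite exprS mulrCA mevalM fZ' // mul0r.
have [|fZ|] := Zprime f (\sum_(j < e) (\sum_i c j.+1 i *: g i) * f ^+ j).
- move=> z Zz; rewrite -[RHS](cZ z Zz) big_ord_recl expr0 mulr1.
  rewrite [X in X + _]big1 ?add0r => [|i _]; last by rewrite c0 scale0r.
  by congr (_.@[_]); rewrite mulr_sumr; apply: eq_bigr => j _; rewrite exprS mulrCA.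
- by move: fz0; rewrite fZ ?eqxx.
- by move=> /(IH (fun j => c j.+1)) {}IH [|j] //; apply: IH.
Qed.

(** The polynomials built here are the monomials in f_0, ..., f_(m-1) with
    exponents below d. *)
Lemma free_on_chain (Z : nat -> set T) (f : nat -> {mpoly k[n]}) m d e :
  Z 0%N !=set0 ->
  (forall j, (j < m)%N -> [/\ Z j `<=` Z j.+1, prime_on (Z j.+1),
      (forall z, Z j z -> (f j).@[t z] = 0),
      (exists2 z, Z j.+1 z & (f j).@[t z] != 0) & (msize (f j) <= e.+1)%N]) ->
  exists (I : finType) (g : I -> {mpoly k[n]}),
    [/\ #|I| = (d ^ m)%N, forall i, (msize (g i) <= (m * (d * e)).+1)%N & free_on g (Z m)].
Proof.
move=> [z0 Zz0]; elim: m => [|m IH] Zf.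
  exists unit, (fun=> 1); split=> [|i|c /(_ z0 Zz0)]; rewrite ?card_unit ?msize1 //.
  rewrite (bigD1 tt) //= big1 ?addr0 => [|[]//]; rewrite mevalZ meval1 mulr1 => c0 [].
  exact: c0.
have [j jm|I [g [cI gM gfree]]] := IH; first by apply: Zf; apply: ltnW.
have [ZZ Zprime fZ fnZ fe] := Zf m (ltnSn m).
exists (I * 'I_d)%type, (fun a : I * 'I_d => g a.1 * f m ^+ a.2); split.
- by rewrite card_prod cI card_ord expnSr.
- move=> [i a] /=; apply: leq_trans (msizeM_deg (gM i) (msizeX_deg a fe)) _.
  by rewrite ltnS mulSn addnC leq_add2r leq_mul2r ltnW ?orbT.
- exact: free_on_powers fnZ gfree.
Qed.

Lemma prime_chain_length (Z : nat -> set T) (f : nat -> {mpoly k[n]}) m :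
  Z 0%N !=set0 ->
  (forall j, (j < m)%N -> [/\ Z j `<=` Z j.+1, prime_on (Z j.+1),
      (forall z, Z j z -> (f j).@[t z] = 0)
    & (exists2 z, Z j.+1 z & (f j).@[t z] != 0)]) ->
  (m <= n)%N.
Proof.
move=> Z0 Zf; pose e := (\sum_(j < m) msize (f j))%N.
(* The independent family has d^m elements of degree at most m d e, hence
   d^m <= (d B)^n; this fails for m > n as soon as d > B^n. *)
pose B := (m * e).+1; pose d := (B ^ n).+1.
have [|I [g [cI gM gfree]]] := @free_on_chain Z f m d e Z0.
  move=> j jm; have [ZZ Zprime fZ fnZ] := Zf j jm; split=> //.
  by apply: leqW; rewrite /e (bigD1 (Ordinal jm)) //= leq_addr.
have := free_family_card gM; rewrite cI => dm.
have {}dm : (d ^ m <= (d * B) ^ n)%N.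
  apply: leq_trans (dm _) _.
    by move=> c c0; apply: gfree => z _; rewrite c0 meval0.
  by apply: leq_exp2n; rewrite /B mulnS mulnCA -addn1 addnC leq_add2r.
rewrite leqNgt; apply/negP => nm; move: dm; rewrite leqNgt expnMn => /negP; apply.
rewrite -(subnK nm) addnC expnD expnSr -mulnA ltn_pmul2l ?expn_gt0 //.
by rewrite -[X in (X < _)%N]muln1 (leq_trans (n := (d * 1)%N)) ?muln1 ?leq_pmulr ?expn_gt0.
Qed.

End GrowthBound.

(** * Irreducible subsets of a topological space *)

Section IrreducibleSets.
Context (T : topologicalType).

Lemma irreducible_connected (Z : set T) : irreducible_set Z -> connected Z.
Proof.
move=> [_ Zirr] B [b Bb] [U Uo BU] [C Cc BC].
have [ZC|ZU] : Z `<=` C \/ Z `<=` ~` U.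
  apply: Zirr => //; first exact: open_closedC.
  move=> z Zz; have [Uz|] := pselect (U z); last by right.
  by left; have : B z by [rewrite BU; split]; rewrite BC => -[].
- by rewrite BC; apply/seteqP; split=> [z []|z Zz] //; split=> //; apply: ZC.
- by move: Bb; rewrite BU => -[/ZU].
Qed.

Lemma closed_union_seq (I : eqType) (r : seq I) (C : I -> set T) :
  (forall i, closed (C i)) -> closed [set z | exists2 i, i \in r & C i z].
Proof.
move=> Cc; elim: r => [|i r IH].
  rewrite [X in closed X](_ : _ = set0) //; last by apply/seteqP; split=> // z [].
  exact: closed0.
rewrite [X in closed X](_ : _ = C i `|` [set z | exists2 i, i \in r & C i z]).
  exact: closedU.
apply/seteqP; split=> z.
  by move=> [j]; rewrite inE => /orP[/eqP->|jr Cj]; [left|right; exists j].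
by move=> [Ci|[j jr Cj]]; [exists i|exists j]; rewrite // inE ?eqxx ?jr ?orbT.
Qed.

Lemma irreducible_cover (Z : set T) (I : eqType) (r : seq I) (C : I -> set T) :
  irreducible_set Z -> (forall i, closed (C i)) ->
  (forall z, Z z -> exists2 i, i \in r & C i z) -> exists i, Z `<=` C i.
Proof.
move=> [[z0 Zz0] Zirr] Cc; elim: r => [/(_ z0 Zz0)[]//|i r IH] ZC.
have [| |z Zz|ZCi|] := Zirr (C i) [set z | exists2 i, i \in r & C i z].
- exact: Cc.
- exact: closed_union_seq.
- have [j] := ZC z Zz; rewrite inE => /orP[/eqP->|jr Cj]; [by left|].
  by right; exists j.
- by exists i.
- exact: IH.
Qed.

End IrreducibleSets.

(** * Coordinates on the cosets of the torus *)

Section Cosets.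
Context (k : fieldType) (n : nat) (D : complex n) (hD : fully_hidden D).
Local Notation A := (sr_ring k D).
Local Notation x := (xbar k D).
Local Notation aut := (sr_aut k D).
Local Notation V := (ind_ambient k D).

(** A single filtration piece carries the whole topology, by [ind_piece1]. *)
Lemma closedP (Z : set aut) : closed Z <->
  exists2 F : set (V -> k), F `<=` @polyfun k V & Z = @ind_coord k n D @^-1` zeros F.
Proof.
rewrite -openC; have -> : open (~` Z) = ind_closed Z.
  by rewrite -[in RHS](setCK Z).
split=> [/(_ 1%N)|[F Fp ZF] d].
  case=> F Fp; have -> : ind_piece 1 = setT :> set aut.
    by apply/seteqP; split=> // f _; apply: (ind_piece1 hD).
  by rewrite !setTI; exists F.
by exists F => //; rewrite -ZF.
Qed.

Lemma closed_polyfun (g : V -> k) : polyfun g ->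
  closed [set f : aut | g (ind_coord f) = 0].
Proof.
move=> gp; apply/closedP; exists [set g] => [_ ->//|].
by apply/seteqP; split=> [f f0 _ ->|f /(_ g)]; last exact.
Qed.

Lemma closed_all (I : Type) (P : I -> Prop) (g : I -> V -> k) :
  (forall i, polyfun (g i)) ->
  closed [set f : aut | forall i, P i -> g i (ind_coord f) = 0].
Proof.
move=> gp; rewrite [X in closed X](_ : _ =
  \bigcap_(i in P) [set f | g i (ind_coord f) = 0]) //.
by apply: closed_bigI => i _; apply: closed_polyfun.
Qed.

Lemma closed_separate (Z : set aut) f : closed Z -> ~ Z f ->
  exists g : V -> k, [/\ polyfun g, forall z, Z z -> g (ind_coord z) = 0
    & g (ind_coord f) != 0].
Proof.
move=> /closedP[F Fp ->] nZ; apply: contrapT => nog; apply: nZ => g Fg.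
apply: contrapT => /eqP gf; apply: nog; exists g; split=> //; first exact: Fp.
by move=> z; apply.
Qed.

(** For a symmetry s of D this is the coset of the torus through s; for any
    other permutation it is empty. *)
Definition coset (s : 'S_n) : set aut :=
  [set f | forall i j, i != s j -> autmx f i j = 0].

Definition coset_coord (s : 'S_n) (f : aut) (j : 'I_n) : k := autmx f (s j) j.

Lemma coset_closed s : closed (coset s).
Proof.
rewrite [X in closed X](_ : _ = [set f : aut | forall ij : 'I_n * 'I_n,
  ij.1 != s ij.2 -> fst_coord ij.1 ij.2 (ind_coord f) = 0]).
  apply: (@closed_all _ (fun ij => ij.1 != s ij.2) (fun ij => fst_coord ij.1 ij.2)) => ij.
  exact: polyfun_fst_coord.
apply/seteqP; split=> f fC => [[i j]|i j] ij; first by rewrite fst_coordE fC.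
by rewrite -fst_coordE (fC (i, j)).
Qed.

Lemma coset_exists f : exists s, coset s f.
Proof.
have [t [s fE]] := aut_monomial hD f; exists (sval s) => i j ij.
by rewrite mxE fE coefxZx (negPf ij).
Qed.

Lemma coset_autE s f j : coset s f -> f (x j) = coset_coord s f j *: x (s j).
Proof.
move=> fC; rewrite (autmx_sum hD) (bigD1 (s j)) //= big1 ?addr0 // => i ij.
by rewrite fC // scale0r.
Qed.

Lemma coset_coord_neq0 s f j : coset s f -> coset_coord s f j != 0.
Proof.
move=> fC; apply/eqP => f0; have := coset_autE j fC; rewrite f0 scale0r.
move=> /(congr1 (aut_inv f)); rewrite aut_funK rmorph0 => /(congr1 (coefx j)).
by rewrite coefx_x eqxx raddf0 => /eqP; rewrite oner_eq0.
Qed.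

Lemma coset_invE s f i j : coset s f ->
  autmx (f^-1)%g i j = if j == s i then (coset_coord s f i)^-1 else 0.
Proof.
move=> fC; rewrite mxE aut_invE; have := coset_autE (s^-1%g j) fC.
rewrite permKV => fE.
have -> : x j = (coset_coord s f (s^-1%g j))^-1 *: f (x (s^-1%g j)).
  by rewrite fE scalerA mulVf ?scale1r // coset_coord_neq0.
rewrite linearZ /= aut_funK coefxZx -(inj_eq (@perm_inj _ s)) permKV eq_sym.
by case: eqP => // ->; rewrite permK.
Qed.

(** [h] is on the coset a Laurent polynomial in the coordinates, whose
    denominator may be taken to be a power of their product. *)
Definition coset_poly (s : 'S_n) (h : aut -> k) : Prop :=
  exists (p : {mpoly k[n]}) (e : nat), forall f, coset s f ->
    h f * (\prod_j coset_coord s f j) ^+ e = p.@[coset_coord s f].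

Lemma prodX_eval (s : 'S_n) f :
  (\prod_j 'X_j : {mpoly k[n]}).@[coset_coord s f] = \prod_j coset_coord s f j.
Proof. by rewrite rmorph_prod; apply: eq_bigr => j _ /=; rewrite mevalXU. Qed.

Lemma coset_polyC s c : coset_poly s (fun=> c).
Proof. by exists c%:MP, 0%N => f _; rewrite mulr1 mevalC. Qed.

Lemma coset_polyD s g h : coset_poly s g -> coset_poly s h ->
  coset_poly s (fun f => g f + h f).
Proof.
move=> [p [d pE]] [q [e qE]]; pose X : {mpoly k[n]} := \prod_j 'X_j.
exists (p * X ^+ e + q * X ^+ d), (d + e)%N => f fC.
rewrite mevalD !mevalM !rmorphXn /= prodX_eval -pE // -qE // mulrDl exprD.
by rewrite -!mulrA [X in h f * X]mulrC.
Qed.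

Lemma coset_polyM s g h : coset_poly s g -> coset_poly s h ->
  coset_poly s (fun f => g f * h f).
Proof.
move=> [p [d pE]] [q [e qE]]; exists (p * q), (d + e)%N => f fC.
by rewrite mevalM -pE // -qE // exprD mulrACA.
Qed.

Lemma coset_poly_sum s (I : Type) (r : seq I) (h : I -> aut -> k) :
  (forall i, coset_poly s (h i)) -> coset_poly s (fun f => \sum_(i <- r) h i f).
Proof.
move=> hp; elim: r => [|i r IH].
  by under eq_fun do rewrite big_nil; apply: coset_polyC.
by under eq_fun do rewrite big_cons; apply: coset_polyD.
Qed.

Lemma coset_poly_entry s i j : coset_poly s (fun f => autmx f i j).
Proof.
have [->|ij] := eqVneq i (s j).
  by exists 'X_j, 0%N => f _; rewrite mulr1 mevalXU.
by exists 0, 0%N => f /(_ i j ij) ->; rewrite mul0r meval0.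
Qed.

Lemma coset_poly_inv_entry s i j : coset_poly s (fun f => autmx (f^-1)%g i j).
Proof.
have [->|ij] := eqVneq j (s i); last first.
  by exists 0, 0%N => f fC; rewrite (coset_invE _ _ fC) (negPf ij) mul0r meval0.
exists (\prod_(l | l != i) 'X_l), 1%N => f fC.
rewrite (coset_invE _ _ fC) eqxx expr1 (bigD1 i) //= mulKf ?coset_coord_neq0 //.
by rewrite rmorph_prod; apply: eq_bigr => l _ /=; rewrite mevalXU.
Qed.

Lemma coset_poly_polyfun s (g : V -> k) :
  polyfun g -> coset_poly s (fun f => g (ind_coord f)).
Proof.
elim=> [c|l|g1 g2 _ IH1 _ IH2|g1 g2 _ IH1 _ IH2].
- exact: coset_polyC.
- have -> : (fun f : aut => l (ind_coord f)) = fun f =>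
      \sum_j \sum_i autmx f i j * l (fst_basis k D i j)
      + \sum_j \sum_i autmx (f^-1)%g i j * l (snd_basis k D i j).
    apply/funext => f; rewrite {1}(ind_coord_sum hD) linearD !linear_sum /=.
    by congr (_ + _); apply: eq_bigr => j _; rewrite linear_sum;
      apply: eq_bigr => i _; rewrite linearZ.
  apply: coset_polyD; apply: coset_poly_sum => j; apply: coset_poly_sum => i;
    (apply: coset_polyM; last exact: coset_polyC).
    exact: coset_poly_entry.
  exact: coset_poly_inv_entry.
- exact: coset_polyD.
- exact: coset_polyM.
Qed.

Lemma coset_polyfun_vanish s (g : V -> k) : polyfun g ->
  exists p : {mpoly k[n]}, forall f, coset s f ->
    (p.@[coset_coord s f] == 0) = (g (ind_coord f) == 0).
Proof.
move=> /(coset_poly_polyfun s)[p [e pE]]; exists p => f fC.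
have X0 : \prod_j coset_coord s f j != 0.
  by apply/prodf_neq0 => j _; apply: coset_coord_neq0.
by rewrite -pE // mulf_eq0 expf_eq0 (negPf X0) andbF orbF.
Qed.

Lemma mpoly_polyfun s (p : {mpoly k[n]}) : exists2 g : V -> k, polyfun g &
  forall f, g (ind_coord f) = p.@[coset_coord s f].
Proof.
exists (fun v => p.@[fun j => fst_coord (s j) j v]).
  by apply: polyfun_mpoly => j; apply: polyfun_fst_coord.
by move=> f; apply: meval_eq => j; rewrite fst_coordE.
Qed.

Lemma closed_mpoly s (p : {mpoly k[n]}) :
  closed [set f : aut | p.@[coset_coord s f] = 0].
Proof.
have [g gp gE] := mpoly_polyfun s p; have := closed_polyfun gp.
by rewrite (_ : [set f | g _ = 0] = [set f : aut | p.@[coset_coord s f] = 0]) //;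
  apply/seteqP; split=> f /=; rewrite gE.
Qed.

Lemma irreducible_prime_on (s : 'S_n) (Z : set aut) :
  irreducible_set Z -> prime_on (coset_coord s) Z.
Proof.
move=> [_ Zirr] p q pq.
have [z Zz|Zp|Zq] := Zirr _ _ (@closed_mpoly s p) (@closed_mpoly s q).
- have /eqP := pq z Zz; rewrite mevalM mulf_eq0.
  by case/orP => /eqP; [left|right].
- by left=> z /Zp.
- by right=> z /Zq.
Qed.

(** The largest member of the chain is irreducible, so it lies in one coset, and
    there polynomial functions are up to units polynomials in n coordinates. *)
Lemma aut_chain_length m : irreducible_chain (sr_aut k D) m -> (m <= n)%N.
Proof.
move=> [Z [Zirr Zlt]].
have [s ZC] : exists s, Z m `<=` coset s.
  apply: (@irreducible_cover _ _ _ (enum 'S_n) coset (Zirr m (leqnn m)).2).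
    exact: coset_closed.
  by move=> f _; have [s fC] := coset_exists f; exists s => //; rewrite mem_enum.
have Zmono i : (i <= m)%N -> Z i `<=` coset s.
  move=> im; apply: subset_trans ZC.
  suff : (i + (m - i) <= m)%N -> Z i `<=` Z (i + (m - i))%N by rewrite subnKC //; apply.
  elim: (m - i)%N => [|d IH]; first by rewrite addn0 => _ z.
  by rewrite addnS => idm; apply: subset_trans (IH (ltnW idm)) (Zlt _ idm).1.
have /choice[p pP] j : exists p : {mpoly k[n]}, (j < m)%N ->
    (forall z, Z j z -> p.@[coset_coord s z] = 0) /\
    (exists2 z, Z j.+1 z & p.@[coset_coord s z] != 0).
  have [jm|] := ltnP j m; last by exists 0.
  have [z [Zz nZz]] : exists z, Z j.+1 z /\ ~ Z j z.
    apply: contrapT => noz; have [_] := Zlt j jm; apply=> z Zz.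
    by apply: contrapT => nZz; apply: noz; exists z.
  have [g [gp gZ gz]] := closed_separate (Zirr j (ltnW jm)).1 nZz.
  have [q qg] := coset_polyfun_vanish s gp; exists q => _; split.
    by move=> y Zy; apply/eqP; rewrite qg ?gZ //; apply: (Zmono j (ltnW jm)).
  by exists z => //; rewrite qg //; apply: Zmono Zz.
apply: (@prime_chain_length k n _ (coset_coord s) Z p).
  by have [] := (Zirr 0%N (leq0n m)).2.
move=> j jm; have [pZ pnZ] := pP j jm; split=> //; first by case: (Zlt j jm).
exact: irreducible_prime_on (Zirr _ jm).2.
Qed.

Lemma torus_coset : range (@torus_aut k n D) = coset 1%g.
Proof.
apply/seteqP; split=> [_ [t _ <-] i j|f fC].
  by rewrite perm1 => ij; rewrite mxE torus_autE coefxZx (negPf ij).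
have f0 j : coset_coord 1%g f j != 0 by apply: coset_coord_neq0.
exists (mk_torus f0) => //; apply: aut_ext => j.
by rewrite torus_autE mk_torusE (coset_autE j fC) perm1.
Qed.

Lemma torus_coord (t : torus k n) : coset_coord 1%g (torus_aut D t) =1 tcoord t.
Proof. by move=> j; rewrite /coset_coord mxE perm1 torus_autE coefxZx eqxx. Qed.

(** The other cosets are cut out together by one equation: the product of the
    diagonal entries is zero. *)
Lemma torus_open : open (range (@torus_aut k n D)).
Proof.
rewrite -closedC torus_coset.
have -> : ~` coset 1%g = [set f : aut | (\prod_j 'X_j : {mpoly k[n]}).@[coset_coord 1%g f] = 0].
  apply/seteqP; split=> f; rewrite /setC /= prodX_eval => fC; last first.
    move=> f1; move/eqP: fC; apply/negP/prodf_neq0 => j _.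
    exact: coset_coord_neq0.
  have [s fs] := coset_exists f.
  have [j sj] : exists j, s j != j.
    apply: contrapT => noj; apply: fC; suff <- : s = 1%g by [].
    apply/permP => j; rewrite perm1; apply: contrapT => /eqP sj.
    by apply: noj; exists j.
  by rewrite (bigD1 j) //= /coset_coord fs ?mul0r // perm1 eq_sym.
exact: closed_mpoly.
Qed.

End Cosets.

(** * Subtori, dimension and the identity component *)

Section Subtori.
Context (k : closedFieldType) (n : nat) (D : complex n) (hD : fully_hidden D).
Local Notation aut := (sr_aut k D).

Lemma horner_mmap (p : {mpoly k[n]}) (l : 'I_n -> {poly k}) c :
  (mmap (@polyC k) l p).[c] = p.@[fun j => (l j).[c]].
Proof.
rewrite mevalE /mmap horner_sum; apply: eq_bigr => m _.
rewrite hornerM hornerC horner_prod; congr (_ * _).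
by apply: eq_bigr => j _; rewrite horner_exp.
Qed.

(** Along the line through a and b both polynomials are nonzero polynomials in
    one variable, and the field is infinite. *)
Lemma generic_point (p q : {mpoly k[n]}) (a b : 'I_n -> k) :
  p.@[a] != 0 -> q.@[b] != 0 ->
  exists2 c, p.@[fun j => a j + c * (b j - a j)] != 0
           & q.@[fun j => a j + c * (b j - a j)] != 0.
Proof.
move=> pa qb; pose l j := (a j)%:P + 'X * (b j - a j)%:P.
have lE c j : (l j).[c] = a j + c * (b j - a j) by rewrite !hornerE.
have evalE r c : (mmap (@polyC k) l r).[c] = r.@[fun j => a j + c * (b j - a j)].
  by rewrite horner_mmap; apply: meval_eq => j; rewrite lE.
have : mmap (@polyC k) l p * mmap (@polyC k) l q != 0.
  rewrite mulf_neq0 //.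
    apply: contraNneq pa => /(congr1 (horner^~ 0)); rewrite horner0 evalE.
    by rewrite (meval_eq (v2 := a)) => [->|j] //; rewrite mul0r addr0.
  apply: contraNneq qb => /(congr1 (horner^~ 1)); rewrite horner0 evalE.
  by rewrite (meval_eq (v2 := b)) => [->|j] //; rewrite mul1r addrC subrK.
move=> /closed_nonrootP[c]; rewrite rootE hornerM !evalE mulf_eq0 negb_or.
by case/andP => pc qc; exists c.
Qed.

Definition subtorus (J : {set 'I_n}) : set aut :=
  [set f | range (@torus_aut k n D) f /\ forall j, j \in J -> coset_coord 1%g f j = 1].

Lemma subtorus_closed J : closed (subtorus J).
Proof.
rewrite /subtorus torus_coset //.
rewrite [X in closed X](_ : _ = coset 1%g `&` [set f : aut | forall j,
    j \in J -> fst_coord ((1%g : 'S_n) j) j (ind_coord f) - 1 = 0]).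
  apply: closedI; first exact: coset_closed.
  apply: (@closed_all _ _ _ hD _ (fun j => j \in J)
    (fun j v => fst_coord ((1%g : 'S_n) j) j v - 1)) => j; apply: polyfun_add; last exact: polyfun_const.
  exact: polyfun_fst_coord.
apply/seteqP; split=> f [f1 fJ]; split=> // j jJ.
  by rewrite fst_coordE [autmx _ _ _](fJ j jJ) subrr.
by have /eqP := fJ j jJ; rewrite fst_coordE subr_eq0 => /eqP.
Qed.

(** Functions not vanishing at a and at b respectively are both nonzero at some
    point of the line through a and b; this line respects the equations t_j = 1
    and meets the torus, as one of the functions is multiplied by the product of
    the coordinates. *)
Lemma subtorus_irreducible J : irreducible_set (subtorus J).
Proof.
split.
  exists (torus_aut D 1%g); split; first by exists 1%g.
  by move=> j _; rewrite torus_coord mk_torusE.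
move=> X Y Xc Yc JXY; apply: contrapT => /not_orP[nX nY].
have separate (W : set aut) : closed W -> ~ (subtorus J `<=` W) ->
    exists2 p : {mpoly k[n]}, forall f, subtorus J f -> W f -> p.@[coset_coord 1%g f] = 0
      & exists2 a, subtorus J a & p.@[coset_coord 1%g a] != 0.
  move=> Wc nW; have [a [Ja nWa]] : exists a, subtorus J a /\ ~ W a.
    apply: contrapT => noa; apply: nW => a Ja; apply: contrapT => nWa.
    by apply: noa; exists a.
  have [g [gp gW ga]] := closed_separate hD Wc nWa.
  have [p pg] := coset_polyfun_vanish hD 1%g gp.
  have JC f : subtorus J f -> coset 1%g f by rewrite -torus_coset // => -[].
  exists p; first by move=> f Jf Wf; apply/eqP; rewrite pg ?gW ?eqxx //; apply: JC.
  by exists a => //; rewrite pg //; apply: JC.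
have [p pX [a [[ta _ aE] Ja] pa]] := separate X Xc nX.
have [q qY [b [[tb _ bE] Jb] qb]] := separate Y Yc nY.
pose XX : {mpoly k[n]} := \prod_j 'X_j.
have XX0 (f : aut) : coset 1%g f -> XX.@[coset_coord 1%g f] != 0.
  by move=> fC; rewrite prodX_eval; apply/prodf_neq0 => j _; apply: coset_coord_neq0.
have [||c] := @generic_point (p * XX) q (coset_coord 1%g a) (coset_coord 1%g b).
- rewrite mevalM; apply: mulf_neq0; first exact: pa.
  apply: XX0; rewrite -(torus_coset k hD).
  by exists ta.
- exact: qb.
set v := fun j => _; rewrite mevalM mulf_eq0 negb_or => /andP[pc XXc] qc.
have v0 j : v j != 0.
  move: XXc; rewrite rmorph_prod /=; apply: contraNneq => vj.
  by rewrite (bigD1 j) //= mevalXU vj mul0r.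
have vE : coset_coord 1%g (torus_aut D (mk_torus v0)) =1 v.
  by move=> j; rewrite torus_coord mk_torusE.
have Jv : subtorus J (torus_aut D (mk_torus v0)).
  split; first by exists (mk_torus v0).
  by move=> j jJ; rewrite vE /v Ja // Jb // subrr mulr0 addr0.
have [/(pX _ Jv)|/(qY _ Jv)] := JXY _ Jv; rewrite (meval_eq (v2 := v)) // => /eqP.
  by rewrite (negPf pc).
by rewrite (negPf qc).
Qed.

Lemma ex_neq01 : exists2 c : k, c != 0 & c != 1.
Proof.
have : 'X * ('X - 1%:P) != 0 :> {poly k} by rewrite mulf_neq0 ?polyX_eq0 ?polyXsubC_eq0.
move=> /closed_nonrootP[c]; rewrite rootE !hornerE mulf_eq0 negb_or subr_eq0.
by case/andP; exists c.
Qed.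

Lemma subtorus_chain m : (m <= n)%N -> irreducible_chain (sr_aut k D) m.
Proof.
move=> mn; exists (fun i => subtorus [set j : 'I_n | (i <= j)%N]%SET); split=> i im.
  by split; [apply: subtorus_closed|apply: subtorus_irreducible].
split=> [f [f1 fi]|].
  by split=> // j; rewrite inE => ij; apply: fi; rewrite inE ltnW.
have [c c0 c1] := ex_neq01; pose j := Ordinal (leq_trans im mn).
have v0 (l : 'I_n) : (if l == j then c else 1) != 0.
  by case: (l == j); last exact: oner_neq0.
move=> /(_ (torus_aut D (mk_torus v0)))[|_ /(_ j)].
  split; first by exists (mk_torus v0).
  move=> l; rewrite inE => il; rewrite torus_coord mk_torusE.
  by case: eqP => // lj; move: il; rewrite lj /= ltnn.
rewrite inE leqnn torus_coord mk_torusE eqxx => /(_ isT)/eqP.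
by rewrite (negPf c1).
Qed.

Lemma torus_connected : connected (range (@torus_aut k n D)).
Proof.
suff <- : subtorus finset.set0 = range (@torus_aut k n D).
  by apply: irreducible_connected; apply: subtorus_irreducible.
by apply/seteqP; split=> [f []|f f1] //; split=> // j; rewrite inE.
Qed.

Lemma torus_identity_component :
  connected_component setT (1%g : aut) = range (@torus_aut k n D).
Proof.
have one_torus : range (@torus_aut k n D) 1%g.
  by exists 1%g => //; apply: aut_ext => i; rewrite torus_autE mk_torusE scale1r.
apply/seteqP; split; last first.
  by apply: connected_component_max => //; apply: torus_connected.
move=> f [C [C1 _ Cconn] Cf].
suff CE : C `&` range (@torus_aut k n D) = C by move: Cf; rewrite -{1}CE => -[].
apply: Cconn; first by exists 1%g.
  by exists (range (@torus_aut k n D)) => //; apply: torus_open.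
by exists (range (@torus_aut k n D)) => //; rewrite torus_coset //; apply: coset_closed.
Qed.

End Subtori.

Theorem theorem3p19 (k : closedFieldType) (n : nat) (D : complex n) :
  [pchar k] =i pred0 -> (0 < n)%N -> fully_hidden D ->
  [/\ (* the two embeddings into Aut(X_D) *)
      [/\ injective (@torus_aut k n D),
          forall s t : torus k n,
            torus_aut D (s * t)%g = (torus_aut D s * torus_aut D t)%g,
          injective (@symm_aut k n D)
        & forall s t u : symm D, (forall i, sval u i = sval s (sval t i)) ->
            symm_aut k u = (symm_aut k s * symm_aut k t)%g],
      internal_semidirect (range (@torus_aut k n D)) (range (@symm_aut k n D)),
      linear_algebraic_aut k D,
      has_dim (sr_aut k D) n
    & connected_component setT (1%g : sr_aut k D) = range (@torus_aut k n D)].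
Proof.
move=> _ _ hD; split.
- split; first exact: torus_aut_inj.
  + exact: torus_autM.
  + exact: symm_aut_inj.
  + exact: symm_autM.
- exact: aut_semidirect.
- exact: aut_linear_algebraic.
- move=> m; split; first exact: aut_chain_length.
  exact: subtorus_chain.
- exact: torus_identity_component.
Qed.
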